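(* Let $R$ be a ring and let $\mathcal{D}$ be the class of all flat Mittag-Leffler right $R$-modules. Given any countable chain $$F_0 \overset{u_0}\longrightarrow F_1 \overset{u_1}\longrightarrow F_2 \overset{u_2}\longrightarrow F_3 \longrightarrow \cdots$$ of morphisms of right $R$-modules such that $F_n \in \mathcal{D}$ for all $n<\omega$, we have $\varinjlim_{n<\omega} F_n \in {}^\perp(\mathcal{D}^\perp)$. If, moreover, $R$ is a countable ring, then the following hold: (1) $\mathcal{D}^\perp$ is precisely the class of all cotorsion right $R$-modules. (2) $\mathcal{D}$ is a precovering class in the category of right $R$-modules if and only if $R$ is right perfect.
   Context: Rings are associative with unit, not necessarily commutative; modules are right $R$-modules unless stated otherwise. A right $R$-module $M$ is called Mittag-Leffler if the canonical morphism $M \otimes_R \prod_{i \in I} Q_i \to \prod_{i \in I} (M \otimes_R Q_i)$ is injective for each family $(Q_i \mid i \in I)$ of left $R$-modules. For a class $\mathcal{C}$ of right $R$-modules, $\mathcal{C}^\perp$ is the class of all right $R$-modules $M$ such that $\operatorname{Ext}^1_R(C,M)=0$ for all $C\in\mathcal{C}$, and ${}^\perp\mathcal{C}$ is the class of all right $R$-modules $M$ such that $\operatorname{Ext}^1_R(M,C)=0$ for all $C\in\mathcal{C}$. A right $R$-module $C$ is cotorsion if $\operatorname{Ext}^1_R(F,C)=0$ for every flat right $R$-module $F$. If $\mathcal{X}$ is a class of modules and $M$ is a module, a homomorphism $f\colon X\to M$ is an $\mathcal{X}$-precover of $M$ if $X\in\mathcal{X}$ and for every homomorphism $f'\colon X'\to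 M$ with $X'\in\mathcal{X}$ there exists a homomorphism $g\colon X'\to X$ with $f'=fg$. The class $\mathcal{X}$ is precovering if every right $R$-module admits an $\mathcal{X}$-precover. A ring $R$ is right perfect if every flat right $R$-module is projective. *)

(* Defs.v *)
From HB Require Import structures.
From mathcomp Require Import all_boot all_algebra.
From mathcomp Require Import finmap boolp classical_sets functions cardinality.
From mathcomp.multinomials Require Import monalg.

Set Implicit Arguments.
Unset Strict Implicit.
Unset Printing Implicit Defensive.

Import GRing.Theory.
Import Quotient.

Local Open Scope ring_scope.
Local Open Scope quotient_scope.

(* Rings are [pzRingType]s: associative, unital, possibly noncommutative and
   possibly zero.  A right R-module is a left module over the converse ring
   R^c, where a * b in R^c is b * a in R, so that m.a := a *: m satisfies
   (m.a).b = m.(a * b). *)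
Notation rmodType R := (lmodType R^c).

Definition ract (R : pzRingType) (M : rmodType R) (m : M) (a : R) : M :=
  (a : R^c) *: m.

Fact ractA (R : pzRingType) (M : rmodType R) (m : M) (a b : R) :
  ract (ract m a) b = ract m (a * b).
Proof. exact: scalerA. Qed.

Section ProductModule.
Variables (S : pzRingType) (I : Type) (Q : I -> lmodType S).

Definition prodmod : Type := forall i : I, Q i.

HB.instance Definition _ := gen_eqMixin prodmod.
HB.instance Definition _ := gen_choiceMixin prodmod.

Let zero : prodmod := fun=> 0.
Let opp (f : prodmod) : prodmod := fun i => - f i.
Let add (f g : prodmod) : prodmod := fun i => f i + g i.
Let scale (a : S) (f : prodmod) : prodmod := fun i => a *: f i.

Fact prodmod_addA : associative add.
Proof. by move=> f g h; apply/functional_extensionality_dep => i; exact: addrA. Qed.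
Fact prodmod_addC : commutative add.
Proof. by move=> f g; apply/functional_extensionality_dep => i; exact: addrC. Qed.
Fact prodmod_add0 : left_id zero add.
Proof. by move=> f; apply/functional_extensionality_dep => i; exact: add0r. Qed.
Fact prodmod_addN : left_inverse zero opp add.
Proof. by move=> f; apply/functional_extensionality_dep => i; exact: addNr. Qed.

HB.instance Definition _ := GRing.isZmodule.Build prodmod
  prodmod_addA prodmod_addC prodmod_add0 prodmod_addN.

Fact prodmod_scaleA a b (f : prodmod) : scale a (scale b f) = scale (a * b) f.
Proof. by apply/functional_extensionality_dep => i; exact: scalerA. Qed.
Fact prodmod_scale1 : left_id 1 scale.
Proof. by move=> f; apply/functional_extensionality_dep => i; exact: scale1r. Qed.
Fact prodmod_scaleDr : right_distributive scale +%R.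
Proof. by move=> a f g; apply/functional_extensionality_dep => i; exact: scalerDr. Qed.
Fact prodmod_scaleDl (f : prodmod) : {morph scale^~ f : a b / a + b}.
Proof. by move=> a b; apply/functional_extensionality_dep => i; exact: scalerDl. Qed.

HB.instance Definition _ := GRing.Zmodule_isLmodule.Build S prodmod
  prodmod_scaleA prodmod_scale1 prodmod_scaleDr prodmod_scaleDl.

Definition prodmod_proj (i : I) (f : prodmod) : Q i := f i.

Fact prodmod_proj_is_linear i : linear (prodmod_proj i).
Proof. by []. Qed.

HB.instance Definition _ i := GRing.isLinear.Build S prodmod (Q i) _
  (prodmod_proj i) (prodmod_proj_is_linear i).

End ProductModule.

Section Tensor.
Variables (R : pzRingType) (M : rmodType R) (N : lmodType R).

Local Notation freeZ := {malg int[(M * N)%type]}.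

Definition tgen (m : M) (n : N) : freeZ := << (m, n) >>.

Inductive tensor_rel : freeZ -> Prop :=
| tensor_rel0 : tensor_rel 0
| tensor_relB x y : tensor_rel x -> tensor_rel y -> tensor_rel (x - y)
| tensor_relDl m m' n : tensor_rel (tgen (m + m') n - (tgen m n + tgen m' n))
| tensor_relDr m n n' : tensor_rel (tgen m (n + n') - (tgen m n + tgen m n'))
| tensor_relA m a n : tensor_rel (tgen (ract m a) n - tgen m (a *: n)).

Definition tensor_relb : {pred freeZ} := fun x => `[< tensor_rel x >].

Fact tensor_relb_zmod_closed : zmod_closed tensor_relb.
Proof.
split; first exact/asboolP/tensor_rel0.
by move=> x y /asboolP hx /asboolP hy; exact/asboolP/tensor_relB.
Qed.

HB.instance Definition _ :=
  GRing.isZmodClosed.Build freeZ tensor_relb tensor_relb_zmod_closed.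

Definition tensor : Type := {quot tensor_relb}.
HB.instance Definition _ := GRing.Zmodule.on tensor.

Definition tens (m : M) (n : N) : tensor := \pi_({quot tensor_relb}) (tgen m n).

Definition balanced (A : zmodType) (b : M -> N -> A) : Prop :=
  [/\ forall m m' n, b (m + m') n = b m n + b m' n,
      forall m n n', b m (n + n') = b m n + b m n'
    & forall m a n, b (ract m a) n = b m (a *: n)].

Definition free_lift (A : zmodType) (b : M -> N -> A) (z : freeZ) : A :=
  \sum_(k <- msupp z) b k.1 k.2 *~ z@_k.

(* The homomorphism out of the tensor product induced by b; meaningful only
   when b is balanced. *)
Definition tensor_lift (A : zmodType) (b : M -> N -> A) (x : tensor) : A :=
  free_lift b (repr (x : {quot tensor_relb})).

Section Lift.
Variables (A : zmodType) (b : M -> N -> A).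

Fact free_liftEw (D : {fset (M * N)%type}) (z : freeZ) :
  (msupp z `<=` D)%fset -> free_lift b z = \sum_(k <- D) b k.1 k.2 *~ z@_k.
Proof.
move=> sD; rewrite /free_lift [RHS](big_fsetID _ (mem (msupp z))) /=.
rewrite [X in _ + X]big1_fset ?addr0; last first.
  move=> k; rewrite !inE => /andP[_ kz] _.
  by rewrite mcoeff_outdom ?mulr0z.
apply: eq_fbigl => k; rewrite !inE /=.
by case: (boolP (k \in msupp z)) => [/(fsubsetP sD) ->|_]; rewrite ?andbF.
Qed.

Fact free_liftB : {morph free_lift b : x y / x - y}.
Proof.
move=> x y; pose D := (msupp x `|` msupp y)%fset.
rewrite (free_liftEw (D := D)) ?msuppB_le //.
rewrite (free_liftEw (D := D) (z := x)) ?fsubsetUl //.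
rewrite (free_liftEw (D := D) (z := y)) ?fsubsetUr //.
by rewrite -sumrB; apply: eq_bigr => k _; rewrite mcoeffB mulrzBr.
Qed.

Fact free_liftU m n : free_lift b (tgen m n) = b m n.
Proof.
rewrite (free_liftEw (D := [fset (m, n)]%fset)) ?msuppU_le //.
by rewrite big_seq_fset1 mcoeffUU.
Qed.

Hypothesis b_bal : balanced b.

Fact free_lift_rel z : tensor_rel z -> free_lift b z = 0.
Proof.
have f0 : free_lift b 0 = 0 by have := free_liftB 0 0; rewrite !subrr.
have fD x y : free_lift b (x + y) = free_lift b x + free_lift b y.
  by rewrite -{1}[y]opprK free_liftB -[- y]sub0r free_liftB f0 sub0r opprK.
case: b_bal => bDl bDr bA.
elim=> [|x y _ hx _ hy|m m' n|m n n'|m a n].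
- exact: f0.
- by rewrite free_liftB hx hy subrr.
- by rewrite free_liftB fD !free_liftU bDl subrr.
- by rewrite free_liftB fD !free_liftU bDr subrr.
- by rewrite free_liftB !free_liftU bA subrr.
Qed.

Fact tensor_lift_pi (z : freeZ) :
  tensor_lift b (\pi_({quot tensor_relb}) z) = free_lift b z.
Proof.
apply/eqP; rewrite -subr_eq0 -free_liftB; apply/eqP/free_lift_rel/asboolP.
have : repr (\pi_({quot tensor_relb}) z) == z %[mod {quot tensor_relb}].
  by rewrite reprK.
by rewrite -idealrBE.
Qed.

Fact tensor_lift_tens m n : tensor_lift b (tens m n) = b m n.
Proof. by rewrite tensor_lift_pi free_liftU. Qed.

Fact tensor_lift_is_zmod_morphism : zmod_morphism (tensor_lift b).
Proof.
move=> x y; rewrite -[x in LHS]reprK -[y in LHS]reprK -raddfB.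
by rewrite tensor_lift_pi free_liftB.
Qed.

End Lift.

Fact tensor_ind (P : tensor -> Prop) :
  (forall m n, P (tens m n)) -> (forall x y, P x -> P y -> P (x - y)) ->
  P 0 -> forall x, P x.
Proof.
move=> Pt PB P0 x; rewrite -[x]reprK; move: (repr _) => z {x}.
have PN x : P x -> P (- x) by move=> Px; rewrite -sub0r; exact: PB.
have PD x y : P x -> P y -> P (x + y).
  by move=> Px Py; rewrite -[y]opprK; apply/PB/PN.
rewrite [z]monalgE raddf_sum /=.
elim/big_ind: _ => //= -[m n] _.
have PMn k : P (tens m n *+ k).
  by elim: k => [|k IH]; rewrite ?mulr0n // mulrS; exact: PD.
have -> : << z@_(m, n) *g (m, n) >> = tgen m n *~ z@_(m, n).
  by rewrite /tgen -(raddfMz (mkmalgU (m, n))) intz.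
rewrite raddfMz; case: (z@_(m, n)) => k; first by rewrite -pmulrn; exact: PMn.
by rewrite NegzE -nmulrn; exact/PN/PMn.
Qed.

End Tensor.

Section TensorMap.
Variables (R : pzRingType) (M M' : rmodType R) (N N' : lmodType R).

Definition tensor_map (f : {linear M -> M'}) (g : {linear N -> N'}) :
  tensor M N -> tensor M' N' := tensor_lift (fun m n => tens (f m) (g n)).

End TensorMap.

Fact tens_balanced (R : pzRingType) (M : rmodType R) (N : lmodType R) :
  balanced (@tens R M N).
Proof.
have rel0 z : tensor_rel z -> \pi_({quot @tensor_relb R M N}) z = 0 :> tensor M N.
  move=> hz; rewrite -(raddf0 (\pi_({quot @tensor_relb R M N}))).
  by apply/eqP; rewrite -idealrBE subr0; apply/asboolP.
split=> [m m' n|m n n'|m a n]; apply/eqP; rewrite -subr_eq0; apply/eqP.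
- by rewrite /tens -raddfD -raddfB; exact/rel0/tensor_relDl.
- by rewrite /tens -raddfD -raddfB; exact/rel0/tensor_relDr.
- by rewrite /tens -raddfB; exact/rel0/tensor_relA.
Qed.

Fact tensor_map_balanced (R : pzRingType) (M M' : rmodType R) (N N' : lmodType R)
  (f : {linear M -> M'}) (g : {linear N -> N'}) :
  balanced (fun m n => tens (f m) (g n)).
Proof.
case: (tens_balanced M' N') => hl hr ha.
split=> [m m' n|m n n'|m a n]; first by rewrite raddfD hl.
  by rewrite raddfD hr.
by rewrite /ract !linearZ -ha.
Qed.

Fact tensor_mapE (R : pzRingType) (M M' : rmodType R) (N N' : lmodType R)
  (f : {linear M -> M'}) (g : {linear N -> N'}) m n :
  tensor_map f g (tens m n) = tens (f m) (g n).
Proof. exact: tensor_lift_tens (tensor_map_balanced f g) m n. Qed.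

Section FlatMittagLeffler.
Variable R : pzRingType.

Definition flat (M : rmodType R) : Prop :=
  forall (N N' : lmodType R) (g : {linear N -> N'}),
    injective g -> injective (tensor_map (idfun : {linear M -> M}) g).

Definition tensor_prod_map (M : rmodType R) (I : Type) (Q : I -> lmodType R)
    (x : tensor M (prodmod Q)) : forall i, tensor M (Q i) :=
  fun i => tensor_map (idfun : {linear M -> M}) (@prodmod_proj R I Q i) x.

Definition mittag_leffler (M : rmodType R) : Prop :=
  forall (I : Type) (Q : I -> lmodType R), injective (@tensor_prod_map M I Q).

Definition flat_ML (M : rmodType R) : Prop := flat M /\ mittag_leffler M.

End FlatMittagLeffler.

Section Homological.
Variable S : pzRingType.

Definition projective (P : lmodType S) : Prop :=
  forall (A B : lmodType S) (p : {linear A -> B}) (f : {linear P -> B}),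
    (forall y, exists x, p x = y) ->
    exists h : {linear P -> A}, forall x, p (h x) = f x.

Record proj_resolution (C : lmodType S) := ProjResolution {
  res_obj : nat -> lmodType S;
  res_d : forall n, {linear res_obj n.+1 -> res_obj n};
  res_aug : {linear res_obj 0 -> C};
  res_proj : forall n, projective (res_obj n);
  res_aug_surj : forall c, exists x, res_aug x = c;
  res_exact0 : forall x, res_aug x = 0 <-> exists y, res_d 0 y = x;
  res_exact : forall n x, res_d n x = 0 <-> exists y, res_d n.+1 y = x
}.

(* Ext^1(C, M) is the first cohomology group of the complex Hom(P, M) for P a
   projective resolution of C, and does not depend on P; it vanishes when every
   1-cocycle is a 1-coboundary. *)
Definition Ext1_eq0 (C M : lmodType S) : Prop :=
  forall (P : proj_resolution C) (f : {linear res_obj P 1 -> M}),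
    (forall x, f (res_d P 1 x) = 0) ->
    exists g : {linear res_obj P 0 -> M}, forall x, f x = g (res_d P 0 x).

Definition right_perp (X : lmodType S -> Prop) (M : lmodType S) : Prop :=
  forall C, X C -> Ext1_eq0 C M.

Definition left_perp (X : lmodType S -> Prop) (M : lmodType S) : Prop :=
  forall C, X C -> Ext1_eq0 M C.

Definition precover (X : lmodType S -> Prop) (A M : lmodType S)
    (f : {linear A -> M}) : Prop :=
  X A /\ forall (B : lmodType S) (f' : {linear B -> M}), X B ->
    exists g : {linear B -> A}, forall x, f' x = f (g x).

Definition precovering (X : lmodType S -> Prop) : Prop :=
  forall M : lmodType S, exists (A : lmodType S) (f : {linear A -> M}),
    precover X f.

(* Direct limits are determined up to isomorphism only, so they are given by
   their universal property: v is the colimit cocone of the chain (F, u). *)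
Definition is_direct_limit (F : nat -> lmodType S)
    (u : forall n, {linear F n -> F n.+1})
    (L : lmodType S) (v : forall n, {linear F n -> L}) : Prop :=
  (forall n x, v n.+1 (u n x) = v n x) /\
  forall (X : lmodType S) (w : forall n, {linear F n -> X}),
    (forall n x, w n.+1 (u n x) = w n x) ->
    exists h : {linear L -> X}, (forall n x, h (v n x) = w n x) /\
      forall h' : {linear L -> X}, (forall n x, h' (v n x) = w n x) -> h' =1 h.

End Homological.

Definition cotorsion (R : pzRingType) (M : rmodType R) : Prop :=
  forall F : rmodType R, flat F -> Ext1_eq0 F M.

Definition right_perfect (R : pzRingType) : Prop :=
  forall F : rmodType R, flat F -> projective F.

(* Main.v *)
Require Import Defs.
From HB Require Import structures.
From mathcomp Require Import all_boot all_algebra.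
From mathcomp Require Import boolp classical_sets cardinality.
From mathcomp.multinomials Require Import monalg.

Set Implicit Arguments.
Unset Strict Implicit.
Unset Printing Implicit Defensive.

(** One construction carries the proof. Let L be the direct limit
    of a chain F_0 -> F_1 -> ... of flat Mittag-Leffler modules and let f : A -> L.
    Consider the tree whose nodes of height n+1 extend a node of height n by a
    function assigning to every node of height n a homomorphism F_n -> A. A
    branch b of this tree then prescribes a homomorphism b_s : F_n -> A for every
    node s, of every height n. Let E be generated by copies of F_n at the nodes s
    of height n and of all the F_n along every branch b, where the element
    (b, n, x) is identified with x at the node b|n plus (b, n+1, u_n x). Locally E
    is a direct summand of a direct sum of F_n's, so it is flat Mittag-Leffler,
    and E modulo the node copies is a direct sum of copies of L, one for each
    branch. If every map from E to L lifts through f, then f splits: the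
    restriction to the nodes of a lift E -> A is itself a branch, and a diagonal
    choice of the map E -> L makes this branch produce a section.

    With f : X -> L an extension of L by a module M of D^perp this gives
    Ext^1(L, M) = 0; with f a D-precover it shows that L is a summand of a module
    of D.

    Over a countable ring, a countable flat module is the limit of a chain of
    free modules of countable rank (relations are killed one at a time), and
    every flat module is filtered by countable flat modules with flat
    quotients, so that, by Zorn's lemma, M is cotorsion as soon as
    Ext^1(C, M) = 0 for countable flat C. Finally a countable flat
    Mittag-Leffler module is projective: each tuple factors as x = y A with A a
    left multiple of A' for every other factorization x = y' A', and this
    stability allows lifts along the chain to be corrected. *)

Import GRing.Theory Quotient.
Local Open Scope ring_scope.
Local Open Scope quotient_scope.

(** * Submodules, quotients and direct sums *)

(** Homomorphisms are often given by a graph, with values read off from preimages. Subtracting two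
    pairs over one point gives a pair over 0, so single-valuedness need only be checked there. *)
Lemma lin_of_rel (S : pzRingType) (X Y : lmodType S) (G : X -> Y -> Prop) :
  (forall x, exists y, G x y) ->
  (forall a x y x' y', G x y -> G x' y' -> G (a *: x + x') (a *: y + y')) ->
  (forall y, G 0 y -> y = 0) ->
  exists h : {linear X -> Y}, forall x y, G x y <-> y = h x.
Proof.
move=> Gt Gl G0; have [h hP] := choice Gt.
have Gu x y y' : G x y -> G x y' -> y = y'.
  move=> /(Gl (-1) _ _ _ _) k /k; rewrite !scaleN1r addNr => /G0/eqP.
  by rewrite addrC subr_eq0 => /eqP.
have hl : linear h by move=> a x x'; apply: Gu (hP _) _; apply: Gl.
pose hL : {linear X -> Y} := HB.pack h (GRing.isLinear.Build _ _ _ _ h hl).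
by exists hL => x y; split=> [|->]; [move/Gu; apply | apply: hP].
Qed.

Section Submodule.
Variables (S : pzRingType) (X : lmodType S).

Definition submodule (N : X -> Prop) :=
  N 0 /\ forall a x y, N x -> N y -> N (a *: x + y).

Variables (N : X -> Prop) (NP : submodule N).

Definition subm_pred of submodule N : {pred X} := fun x => `[< N x >].
Local Notation Nb := (subm_pred NP).

Fact subm_pred_closed : submod_closed Nb.
Proof.
case: (NP) => N0 Nl; split; first exact/asboolP.
by move=> a x y /asboolP hx /asboolP hy; apply/asboolP/Nl.
Qed.

HB.instance Definition _ := GRing.isSubmodClosed.Build S X Nb subm_pred_closed.

Record subm_type := Subm { subm_val : X; _ : Nb subm_val }.
HB.instance Definition _ := [isSub for subm_val].
HB.instance Definition _ := [Choice of subm_type by <:].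
HB.instance Definition _ := [SubChoice_isSubLmodule of subm_type by <:].

Lemma submodule_exists : exists (K : lmodType S) (i : {linear K -> X}),
  injective i /\ forall x, N x <-> exists k, i k = x.
Proof.
exists subm_type, (val : {linear subm_type -> X}); split; first exact: val_inj.
move=> x; split=> [/asboolP Nx|[k <-]]; first by exists (Subm Nx).
by case: k => k /= /asboolP.
Qed.

Definition quot_type := {quot Nb}.
HB.instance Definition _ := GRing.Zmodule.on quot_type.

Definition quot_pi (x : X) : quot_type := \pi_({quot Nb}) x.
Definition quot_repr (q : quot_type) : X := repr (q : {quot Nb}).
Local Notation pi := quot_pi.

Let quot_reprK q : pi (quot_repr q) = q. Proof. exact: reprK. Qed.

Let quot_piB x y : pi (x - y) = pi x - pi y. Proof. exact: raddfB. Qed.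

Let quot_pi0 x : N x <-> pi x = 0.
Proof.
have e0 : pi 0 = 0 by rewrite -(subrr (pi 0)) -quot_piB subrr.
have : (x - 0 \in Nb) = (pi x == pi 0) by rewrite idealrBE.
rewrite subr0 e0 => xE; split=> [Nx|/eqP]; last by rewrite -xE => /asboolP.
by apply/eqP; rewrite -xE; apply/asboolP.
Qed.

Let quot_piE x y : N (x - y) -> pi x = pi y.
Proof. by move/quot_pi0; rewrite quot_piB => /eqP; rewrite subr_eq0 => /eqP. Qed.

Definition quot_scale (a : S) (q : quot_type) := pi (a *: quot_repr q).

Let quot_scale_pi a x : quot_scale a (pi x) = pi (a *: x).
Proof.
have [N0 NPl] := NP; apply: quot_piE; rewrite -scalerBr -[_ *: _]addr0.
by apply: NPl => //; apply/quot_pi0; rewrite quot_piB quot_reprK subrr.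
Qed.

Let quot_piD x y : pi (x + y) = pi x + pi y. Proof. exact: raddfD. Qed.

Fact quot_scaleA a b q : quot_scale a (quot_scale b q) = quot_scale (a * b) q.
Proof. by rewrite -[q]quot_reprK !quot_scale_pi scalerA. Qed.
Fact quot_scale1 : left_id 1 quot_scale.
Proof. by move=> q; rewrite -[q]quot_reprK !quot_scale_pi scale1r. Qed.
Fact quot_scaleDr : right_distributive quot_scale +%R.
Proof.
move=> a p q; rewrite -[p]quot_reprK -[q]quot_reprK -quot_piD !quot_scale_pi.
by rewrite scalerDr quot_piD.
Qed.
Fact quot_scaleDl q : {morph quot_scale^~ q : a b / a + b}.
Proof.
by move=> a b; rewrite -[q]quot_reprK !quot_scale_pi scalerDl quot_piD.
Qed.

HB.instance Definition _ := GRing.Zmodule_isLmodule.Build S quot_type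
  quot_scaleA quot_scale1 quot_scaleDr quot_scaleDl.

Fact quot_pi_linear : linear quot_pi.
Proof. by move=> a x y; rewrite quot_piD -quot_scale_pi. Qed.

HB.instance Definition _ := GRing.isLinear.Build S X quot_type _ quot_pi
  quot_pi_linear.

Lemma quotient_exists : exists (Q : lmodType S) (p : {linear X -> Q}),
  (forall q, exists x, p x = q) /\ forall x, N x <-> p x = 0.
Proof.
exists quot_type, (quot_pi : {linear X -> quot_type}).
by split=> // q; exists (quot_repr q).
Qed.

End Submodule.

Section DirectSum.
Variables (S : pzRingType) (I : eqType) (F : I -> lmodType S).

(** A direct sum up to isomorphism. Supports are lists, hence the [eqType] index; other index types
    enter through [{classic _}]. *)
Definition is_dsum (D : lmodType S) (inj : forall i, {linear F i -> D})
    (proj : forall i, {linear D -> F i}) : Prop :=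
  [/\ forall i x, proj i (inj i x) = x,
      forall i j x, i != j -> proj j (inj i x) = 0,
      forall d, exists s : seq I, forall i, i \notin s -> proj i d = 0
    & forall d, (forall i, proj i d = 0) -> d = 0].

Let inj0 i (x : F i) : prodmod F :=
  fun j => if eqP is ReflectT e in reflect _ b return F j
           then ecast j (F j) e x else 0.

Lemma dsum_exists : exists D inj proj, @is_dsum D inj proj.
Proof.
pose N (f : prodmod F) := exists s : seq I, forall i, i \notin s -> f i = 0.
have NP : submodule N.
  split=> [|a f g [s fs] [t gt]]; first by exists [::].
  exists (s ++ t) => i; rewrite mem_cat negb_or => /andP[/fs fi /gt gi].
  by rewrite -[LHS]/(a *: f i + g i) fi gi scaler0 addr0.
have [D [val [val_inj valP]]] := submodule_exists NP.
have injE i (x : F i) : inj0 x i = x.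
  by rewrite /inj0; case: eqP => // e; rewrite (eq_axiomK e).
have injN i j (x : F i) : i != j -> inj0 x j = 0.
  by rewrite /inj0; case: eqP.
have inj_exists i : exists h : {linear F i -> D}, forall x, val (h x) = inj0 x.
  have [||y|h hP] := @lin_of_rel S (F i) D (fun x d => val d = inj0 x).
  - move=> x; apply/valP; exists [:: i] => j; rewrite inE eq_sym; exact: injN.
  - move=> a x y x' y' hx hy; rewrite linearP hx hy.
    apply/functional_extensionality_dep => j.
    rewrite -[LHS]/(a *: inj0 x j + inj0 x' j).
    case: (eqVneq i j) => [<-|ij]; first by rewrite !injE.
    by rewrite !(injN _ _ _ ij) scaler0 addr0.
  - move=> h; apply: val_inj; rewrite h raddf0.
    apply/functional_extensionality_dep => j.
    by case: (eqVneq i j) => [<-|ij]; rewrite ?injE ?(injN _ _ _ ij).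
  - by exists h => x; apply/hP.
pose inj i := sval (cid (inj_exists i)).
have injP i : forall x, val (inj i x) = inj0 x := svalP (cid (inj_exists i)).
exists D, inj, (fun i => @prodmod_proj S I F i \o val).
split=> [i x|i j x ij|d|d d0] /=; rewrite ?injP.
- exact: injE.
- exact: injN.
- by apply/(valP (val d)); exists d.
- by apply: val_inj; rewrite raddf0; apply/functional_extensionality_dep.
Qed.

Variables (D : lmodType S) (inj : forall i, {linear F i -> D})
  (proj : forall i, {linear D -> F i}).
Hypothesis HD : is_dsum inj proj.

Lemma dsum_proj_sum i s (x : forall i, F i) : uniq s ->
  proj i (\sum_(j <- s) inj j (x j)) = if i \in s then x i else 0.
Proof.
case: HD => injK injN _ _ us; rewrite raddf_sum; case: ifPn => [si|sNi].
  rewrite (big_rem i) //= injK big_seq big1 ?addr0 // => j.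
  by rewrite mem_rem_uniq // inE => /andP[ji _]; exact: injN.
by rewrite big_seq big1 // => j sj; apply: injN; apply: contraNneq sNi => <-.
Qed.

Lemma dsum_decomp d :
  exists2 s : seq I, uniq s & d = \sum_(j <- s) inj j (proj j d).
Proof.
case: (HD) => _ _ /(_ d) [s sP] ext; exists (undup s); first exact: undup_uniq.
apply/eqP; rewrite -subr_eq0; apply/eqP/ext => i.
rewrite raddfB; have /= -> := dsum_proj_sum i (proj^~ d) (undup_uniq s).
rewrite mem_undup.
by case: ifPn => [_|/sP ->]; rewrite subrr.
Qed.

(** The image of d is a sum over any list containing its support; [enlarge] lets two such lists be
    replaced by a common one. *)
Lemma dsum_lift (Y : lmodType S) (g : forall i, {linear F i -> Y}) :
  exists h : {linear D -> Y}, forall i x, h (inj i x) = g i x.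
Proof.
case: (HD) => injK injN fin ext.
pose G d y := exists s, [/\ uniq s, forall i, i \notin s -> proj i d = 0
   & y = \sum_(j <- s) g j (proj j d)].
have enlarge d y s t : uniq s -> uniq t -> {subset s <= t} ->
  (forall i, i \notin s -> proj i d = 0) -> y = \sum_(j <- s) g j (proj j d) ->
  y = \sum_(j <- t) g j (proj j d).
  move=> us ut st ds ->; rewrite [RHS](bigID (mem s)) /=.
  rewrite [X in _ + X]big1 ?addr0 => [|j /ds ->]; last by rewrite raddf0.
  rewrite -[RHS]big_filter; apply: perm_big; apply: uniq_perm => //.
    exact: filter_uniq.
  by move=> j; rewrite mem_filter; case sj: (j \in s); rewrite //= st.
have [||y|h hP] := @lin_of_rel S D Y G.
- by move=> d; have [s sP] := fin d; exists (\sum_(j <- undup s) g j (proj j d)),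
    (undup s); split=> [|i|//]; rewrite ?undup_uniq ?mem_undup //; exact: sP.
- move=> a d y d' y' [s [us ds ys]] [t [ut dt yt]].
  have uu := undup_uniq (s ++ t).
  have su : {subset s <= undup (s ++ t)}.
    by move=> i; rewrite mem_undup mem_cat => ->.
  have tu : {subset t <= undup (s ++ t)}.
    by move=> i; rewrite mem_undup mem_cat => ->; rewrite orbT.
  exists (undup (s ++ t)); split=> // [i iN|].
    by rewrite linearP ds ?dt ?scaler0 ?addr0 //; apply: contraNN iN; auto.
  rewrite (enlarge _ _ _ _ us uu su ds ys) (enlarge _ _ _ _ ut uu tu dt yt).
  rewrite scaler_sumr -big_split; apply: eq_bigr => i _.
  by rewrite !linearP.
- by case=> s [_ _ ->]; rewrite big1 // => i _; rewrite !raddf0.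
exists h => i x; apply/esym/hP; exists [:: i]; split=> // [j|].
  by rewrite inE eq_sym; exact: injN.
by rewrite big_seq1 injK.
Qed.

Lemma dsum_ind (P : D -> Prop) : P 0 -> (forall x y, P x -> P y -> P (x + y)) ->
  (forall i x, P (inj i x)) -> forall d, P d.
Proof. by move=> P0 PD Pi d; have [s _ ->] := dsum_decomp d; apply: big_ind. Qed.

End DirectSum.

Lemma factor_surj (S : pzRingType) (X Q Y : lmodType S) (p : {linear X -> Q})
    (f : {linear X -> Y}) :
  (forall q, exists x, p x = q) -> (forall x, p x = 0 -> f x = 0) ->
  exists h : {linear Q -> Y}, forall x, h (p x) = f x.
Proof.
move=> sp kf.
have [||y|h hP] := @lin_of_rel S Q Y (fun q y => exists2 x, p x = q & f x = y).
- by move=> q; have [x <-] := sp q; exists (f x), x.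
- by move=> a q y q' y' [x <- <-] [x' <- <-]; exists (a *: x + x'); rewrite linearP.
- by case=> x /kf -> <-.
- by exists h => x; apply/esym/hP; exists x.
Qed.

(** * Flat Mittag-Leffler modules *)

Section TensorMaps.
Variable R : pzRingType.
Implicit Types (M : rmodType R) (N : lmodType R).

Lemma tens0l M N (n : N) : tens (0 : M) n = 0.
Proof.
have [hl _ _] := tens_balanced M N.
by apply: (@addrI _ (tens (0 : M) n)); rewrite -hl !addr0.
Qed.

Lemma tens0r M N (m : M) : tens m (0 : N) = 0.
Proof.
have [_ hr _] := tens_balanced M N.
by apply: (@addrI _ (tens m (0 : N))); rewrite -hr !addr0.
Qed.

Lemma tensor_mapB M M' N N' (f : {linear M -> M'}) (g : {linear N -> N'}) :
  {morph tensor_map f g : x y / x - y}.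
Proof. exact: tensor_lift_is_zmod_morphism (tensor_map_balanced f g). Qed.

Lemma tensor_map0 M M' N N' (f : {linear M -> M'}) (g : {linear N -> N'}) :
  tensor_map f g 0 = 0.
Proof. by rewrite -[in LHS](subrr 0) tensor_mapB subrr. Qed.

Lemma tensor_mapD M M' N N' (f : {linear M -> M'}) (g : {linear N -> N'}) :
  {morph tensor_map f g : x y / x + y}.
Proof.
move=> x y; rewrite -[y in LHS]opprK tensor_mapB -[- y]sub0r tensor_mapB.
by rewrite tensor_map0 sub0r opprK.
Qed.

Lemma tensor_map_comp M M' M'' N N' N'' (f : {linear M -> M'})
    (f' : {linear M' -> M''}) (g : {linear N -> N'}) (g' : {linear N' -> N''}) x :
  tensor_map f' g' (tensor_map f g x) = tensor_map (f' \o f) (g' \o g) x.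
Proof.
elim/tensor_ind: x => [m n|x y hx hy|]; first by rewrite !tensor_mapE.
  by rewrite !tensor_mapB hx hy.
by rewrite !tensor_map0.
Qed.

Lemma tensor_map_eq M M' N N' (f f' : {linear M -> M'})
    (g g' : {linear N -> N'}) x :
  f =1 f' -> g =1 g' -> tensor_map f g x = tensor_map f' g' x.
Proof.
move=> ff' gg'; elim/tensor_ind: x => [m n|x y hx hy|].
- by rewrite !tensor_mapE ff' gg'.
- by rewrite !tensor_mapB hx hy.
- by rewrite !tensor_map0.
Qed.

Lemma tensor_map_id M N (x : tensor M N) :
  tensor_map (idfun : {linear M -> M}) idfun x = x.
Proof.
elim/tensor_ind: x => [m n|x y hx hy|]; first by rewrite tensor_mapE.
  by rewrite tensor_mapB hx hy.
by rewrite tensor_map0.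
Qed.

(** A tensor is a finite combination of pure tensors, and only their left factors matter here. *)
Lemma tensor_support M N (x : tensor M N) : exists es : seq M,
  forall M' (f f' : {linear M -> M'}), {in es, f =1 f'} ->
    tensor_map f idfun x = tensor_map f' idfun x.
Proof.
elim/tensor_ind: x => [m n|x y [s hs] [t ht]|].
- exists [:: m] => M' f f' ff'; rewrite !tensor_mapE ff' // inE eqxx //.
- exists (s ++ t) => M' f f' ff'; rewrite !tensor_mapB.
  by rewrite (hs _ f f') ?(ht _ f f') // => e he; apply: ff';
     rewrite mem_cat he ?orbT.
- by exists [::] => M' f f' _; rewrite !tensor_map0.
Qed.

(** Flatness is the case of a single injective map, the Mittag-Leffler property that of the
    projections of a product. *)
Definition separated M N (I : Type) (Q : I -> lmodType R)
    (g : forall i, {linear N -> Q i}) : Prop :=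
  forall x : tensor M N,
    (forall i, tensor_map (idfun : {linear M -> M}) (g i) x = 0) -> x = 0.

Lemma flatP M : flat M <-> forall N N' (g : {linear N -> N'}),
  injective g -> separated M (fun _ : unit => g).
Proof.
split=> H N N' g ginj => [x /(_ tt) gx|x y xy].
  by apply: H ginj _ _ _; rewrite gx tensor_map0.
apply/eqP; rewrite -subr_eq0; apply/eqP/(H _ _ _ ginj) => _.
by rewrite tensor_mapB xy subrr.
Qed.

Lemma mittag_lefflerP M : mittag_leffler M <->
  forall (I : Type) (Q : I -> lmodType R), separated M (@prodmod_proj R I Q).
Proof.
split=> H I Q => [x px|x y xy].
  apply: H; apply/functional_extensionality_dep => i.
  by rewrite /tensor_prod_map px tensor_map0.
apply/eqP; rewrite -subr_eq0; apply/eqP/H => i.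
rewrite tensor_mapB -[tensor_map _ _ x]/(tensor_prod_map x i) xy.
exact: subrr.
Qed.

(** In both conditions the maps g are jointly injective, so one separation argument transfers both
    at once. *)
Lemma flat_ML_trans (P : rmodType R -> Prop) M :
  (forall G, P G -> flat_ML G) ->
  (forall N I (Q : I -> lmodType R) (g : forall i, {linear N -> Q i}),
     (forall n, (forall i, g i n = 0) -> n = 0) ->
     (forall G, P G -> separated G g) -> separated M g) ->
  flat_ML M.
Proof.
move=> PML sepM; split.
  apply/flatP => N N' g ginj; apply: sepM => [n /(_ tt) gn|G PG].
    by apply: ginj; rewrite gn raddf0.
  by have [/flatP fG _] := PML G PG; apply: fG.
apply/mittag_lefflerP => I Q; apply: sepM => [n nI|G PG].
  exact/functional_extensionality_dep.
by have [_ /mittag_lefflerP mG] := PML G PG; apply: mG.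
Qed.

(** By [tensor_support], a tensor is fixed by (b a) tensor 1 for suitable a and b, and its image
    under a tensor 1 vanishes because G separates. *)
Lemma flat_ML_local M :
  (forall es : seq M, exists (G : rmodType R) (a : {linear M -> G})
       (b : {linear G -> M}),
     flat_ML G /\ {in es, cancel a b}) ->
  flat_ML M.
Proof.
move=> loc; apply: (@flat_ML_trans (@flat_ML R)) => // N I Q g _ sepG x xI.
have [es esP] := tensor_support x.
have [G [a [b [GML ab]]]] := loc es.
have bax : tensor_map b idfun (tensor_map a idfun x) = x.
  rewrite tensor_map_comp -[RHS]tensor_map_id.
  rewrite (@tensor_map_eq _ _ _ _ _ (b \o a) _ idfun) //.
  by apply: esP => e /ab.
rewrite -bax (sepG G GML (tensor_map a idfun x)) ?tensor_map0 // => i.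
rewrite tensor_map_comp.
rewrite (@tensor_map_eq _ _ _ _ _ (a \o idfun) _ (idfun \o g i)) //.
by rewrite -tensor_map_comp xI tensor_map0.
Qed.

Lemma flat_ML_retract M (G : rmodType R) (a : {linear M -> G})
    (b : {linear G -> M}) :
  flat_ML G -> cancel a b -> flat_ML M.
Proof.
move=> GML ab; apply: flat_ML_local => es.
by exists G, a, b; split=> // e _; apply: ab.
Qed.

(** The components of x vanish by separation in the summands, and a finite sum of the idempotents
    [inj i \o proj i] fixes the finitely many elements of D on which x depends. *)
Lemma flat_ML_dsum (I : eqType) (F : I -> rmodType R) D inj proj :
  @is_dsum _ I F D inj proj -> (forall i, flat_ML (F i)) -> flat_ML D.
Proof.
move=> HD FML; apply: (@flat_ML_trans (fun G => exists i, G = F i)).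
  by move=> _ [i ->].
move=> N J Q g _ sepF x xJ.
have projx i : tensor_map (proj i) idfun x = 0.
  apply: (sepF (F i)) => [|j]; first by exists i.
  rewrite tensor_map_comp.
  rewrite (@tensor_map_eq _ _ _ _ _ (proj i \o idfun) _ (idfun \o g j)) //.
  by rewrite -tensor_map_comp xJ tensor_map0.
have [es esP] := tensor_support x.
pose th (s : seq I) (d : D) := \sum_(i <- s) inj i (proj i d).
have thl s : linear (th s).
  move=> a d d'; rewrite /th scaler_sumr -big_split /=.
  by apply: eq_bigr => i _; rewrite !linearP.
pose tl s : {linear D -> D} :=
  HB.pack (th s) (GRing.isLinear.Build _ _ _ _ (th s) (thl s)).
have tl0 s : tensor_map (tl s) idfun x = 0.
  elim: s => [|i s IH].
    rewrite (@tensor_map_eq _ _ _ _ _ (\0 : {linear D -> D}) _ idfun) //; last first.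
      by move=> d; apply: big_nil.
    elim/tensor_ind: (x) => [m n|y z hy hz|]; last exact: tensor_map0.
      by rewrite tensor_mapE tens0l.
    by rewrite tensor_mapB hy hz subrr.
  transitivity (tensor_map (inj i) idfun (tensor_map (proj i) idfun x) +
                tensor_map (tl s) idfun x); last first.
    by rewrite projx tensor_map0 IH addr0.
  rewrite tensor_map_comp; elim/tensor_ind: (x) => [m n|y z hy hz|].
  - rewrite !tensor_mapE; have [hl _ _] := tens_balanced D N.
    by rewrite -hl; congr tens; apply: big_cons.
  - by rewrite !tensor_mapB hy hz opprD addrACA.
  - by rewrite !tensor_map0 addr0.
have [s us sP] : exists2 s : seq I, uniq s & {in es, forall e, th s e = e}.
  have [_ _ fin ext] := HD.
  have [s sP] : exists s : seq I, {in es, forall e i, i \notin s -> proj i e = 0}.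
    elim: es {esP} => [|e es [s sP]]; first by exists [::].
    have [t tP] := fin e; exists (t ++ s) => e' + i.
    rewrite mem_cat negb_or inE => /predU1P[->|e's] /andP[ti si]; first exact: tP.
    exact: sP.
  exists (undup s); first exact: undup_uniq.
  move=> e ee; apply/eqP; rewrite -subr_eq0; apply/eqP/ext => i.
  rewrite raddfB; have /= -> := dsum_proj_sum HD i (proj^~ e) (undup_uniq s).
  by rewrite mem_undup; case: ifPn => [_|/(sP _ ee) ->]; rewrite subrr.
by rewrite -[LHS]tensor_map_id -(tl0 s); apply: esP => e /sP /= ->.
Qed.

(** Every tensor over R has the form 1 tensor n, and multiplication recovers each g_i(n) from its
    image; the test class can be empty. *)
Lemma flat_ML_regular : flat_ML (R^c)^o.
Proof.
apply: (@flat_ML_trans (fun=> False)) => // N I Q g ginj _ x xI.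
have [hl hr ha] := tens_balanced (R^c)^o N.
have [n xE] : exists n : N, x = tens (1 : (R^c)^o) n.
  elim/tensor_ind: x {xI} => [m n|x y [n ->] [n' ->]|].
  - exists ((m : R) *: n); rewrite -ha /ract; congr tens.
    exact/esym/mulr1.
  - exists (n - n'); apply: (@addIr _ (tens (1 : (R^c)^o) n')).
    by rewrite subrK -hr subrK.
  - by exists 0; rewrite tens0r.
rewrite xE (ginj n) ?tens0r // => i.
have bal : balanced (fun (m : (R^c)^o) (q : Q i) => (m : R) *: q).
  split=> [m m' q|m q q'|m a q]; first exact: scalerDl.
    exact: scalerDr.
  by rewrite scalerA.
have := tensor_lift_tens bal 1 (g i n).
rewrite scale1r => <-; rewrite -(tensor_mapE (idfun : {linear (R^c)^o -> _})).
rewrite -xE xI; have B := tensor_lift_is_zmod_morphism bal.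
by have := B 0 0; rewrite !subrr.
Qed.

End TensorMaps.

Lemma free_lift0 (R : pzRingType) (M : rmodType R) (N : lmodType R)
  (A : zmodType) (b : M -> N -> A) : free_lift b 0 = 0.
Proof. by have := free_liftB b 0 0; rewrite !subrr. Qed.

Lemma free_liftD (R : pzRingType) (M : rmodType R) (N : lmodType R)
  (A : zmodType) (b : M -> N -> A) : {morph free_lift b : x y / x + y}.
Proof.
move=> x y; rewrite -{1}[y]opprK free_liftB -[- y]sub0r free_liftB.
by rewrite free_lift0 sub0r opprK.
Qed.

(** * Matrices acting on tuples, and equational criteria *)

Section RightMul.
Variable R : pzRingType.
Implicit Types L : rmodType R.

(** Scalars stand on the right, so that successive substitutions compose by the matrix product over
    R itself, not over [R^c]. *)
Definition rmulmx L m n (y : 'rV[L]_m) (A : 'M[R]_(m, n)) : 'rV[L]_n :=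
  \row_i \sum_j ract (y 0 j) (A j i).

Lemma ractDl L (x y : L) a : ract (x + y) a = ract x a + ract y a.
Proof. exact: scalerDr. Qed.
Lemma ractDr L (x : L) a b : ract x (a + b) = ract x a + ract x b.
Proof. exact: scalerDl. Qed.
Lemma ractNl L (x : L) a : ract (- x) a = - ract x a.
Proof. exact: scalerN. Qed.
Lemma ractNr L (x : L) a : ract x (- a) = - ract x a.
Proof. exact: scaleNr. Qed.
Lemma ract1 L (x : L) : ract x 1 = x.
Proof. exact: scale1r. Qed.
Lemma ractr0 L (x : L) : ract x 0 = 0.
Proof. exact: scale0r. Qed.
Lemma ract_suml L I (s : seq I) (x : I -> L) a :
  ract (\sum_(i <- s) x i) a = \sum_(i <- s) ract (x i) a.
Proof. exact: scaler_sumr. Qed.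
Lemma ract_sumr L I (s : seq I) (x : L) (a : I -> R) :
  ract x (\sum_(i <- s) a i) = \sum_(i <- s) ract x (a i).
Proof. exact: (@scaler_suml R^c). Qed.

Lemma rmulmxA L m n p (y : 'rV[L]_m) (A : 'M[R]_(m, n)) (B : 'M[R]_(n, p)) :
  rmulmx (rmulmx y A) B = rmulmx y (A *m B).
Proof.
apply/rowP => k; rewrite !mxE.
under eq_bigr => j _ do rewrite mxE ract_suml.
rewrite exchange_big; apply: eq_bigr => j _; rewrite mxE ract_sumr.
by apply: eq_bigr => i _; rewrite ractA.
Qed.

Lemma rmulmxDl L m n (y z : 'rV[L]_m) (A : 'M[R]_(m, n)) :
  rmulmx (y + z) A = rmulmx y A + rmulmx z A.
Proof.
apply/rowP => k; rewrite !mxE -big_split; apply: eq_bigr => j _.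
by rewrite mxE ractDl.
Qed.
Lemma rmulmxNl L m n (y : 'rV[L]_m) (A : 'M[R]_(m, n)) :
  rmulmx (- y) A = - rmulmx y A.
Proof.
apply/rowP => k; rewrite !mxE -sumrN; apply: eq_bigr => j _.
by rewrite mxE ractNl.
Qed.
Lemma rmulmxBl L m n (y z : 'rV[L]_m) (A : 'M[R]_(m, n)) :
  rmulmx (y - z) A = rmulmx y A - rmulmx z A.
Proof. by rewrite rmulmxDl rmulmxNl. Qed.
Lemma rmul0mx L m n (A : 'M[R]_(m, n)) : rmulmx (0 : 'rV[L]_m) A = 0.
Proof. by rewrite -(subrr 0) rmulmxBl subrr. Qed.
Lemma rmulmx0 L m n (y : 'rV[L]_m) : rmulmx y (0 : 'M[R]_(m, n)) = 0.
Proof.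
by apply/rowP => k; rewrite !mxE big1 // => j _; rewrite mxE ractr0.
Qed.
Lemma rmulmx1 L m (y : 'rV[L]_m) : rmulmx y 1%:M = y.
Proof.
apply/rowP => k; rewrite !mxE (bigD1 k) //= mxE eqxx ract1.
by rewrite big1 ?addr0 // => j jk; rewrite mxE (negPf jk) ractr0.
Qed.
Lemma rmulmx_block L m m' n (y : 'rV[L]_m) (y' : 'rV[L]_m') (A : 'M[R]_(m, n))
    (A' : 'M[R]_(m', n)) :
  rmulmx (row_mx y y') (col_mx A A') = rmulmx y A + rmulmx y' A'.
Proof.
apply/rowP => k; rewrite !mxE big_split_ord; congr (_ + _).
  by apply: eq_bigr => j _; rewrite row_mxEl col_mxEu.
by apply: eq_bigr => j _; rewrite row_mxEr col_mxEd.
Qed.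
Lemma map_rmulmx L L' (h : {linear L -> L'}) m n (y : 'rV[L]_m)
    (A : 'M[R]_(m, n)) : map_mx h (rmulmx y A) = rmulmx (map_mx h y) A.
Proof.
apply/rowP => k; rewrite !mxE linear_sum; apply: eq_bigr => j _.
by rewrite /ract linearZ_LR mxE.
Qed.

(* The equational criterion for flatness. *)
Definition eqflat L : Prop := forall n (x : 'rV[L]_n) (r : 'cV[R]_n),
  rmulmx x r = 0 ->
  exists m (y : 'rV[L]_m) (A : 'M[R]_(m, n)), x = rmulmx y A /\ A *m r = 0.

(* With K the submodule generated by the q_i, the element already vanishes in the
   tensor product of L and K; writing each k in K as a combination of the q_i
   gives a map L x K -> L^n which is balanced modulo the tuples y A with A q = 0,
   and which sends the element to x. *)
Lemma tens_sum_eq0 (L : rmodType R) (N : lmodType R) n (x : 'rV[L]_n)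
    (q : 'I_n -> N) :
  flat L -> \sum_i tens (x 0 i) (q i) = 0 ->
  exists m (y : 'rV[L]_m) (A : 'M[R]_(m, n)),
    x = rmulmx y A /\ forall j, \sum_i A j i *: q i = 0.
Proof.
move=> fL xq0.
pose N0 (k : N) := exists c : 'rV[R]_n, k = \sum_i c 0 i *: q i.
have N0P : submodule N0.
  split; first by exists 0; rewrite big1 // => i _; rewrite mxE scale0r.
  move=> a _ _ [c ->] [c' ->]; exists (a *: c + c').
  rewrite scaler_sumr -big_split; apply: eq_bigr => i _ /=.
  by rewrite !mxE scalerDl scalerA.
have [K [iota [iinj iP]]] := submodule_exists N0P.
have /choice[k kP] : forall i, exists k, iota k = q i.
  move=> i; apply/iP.
  exists (\row_j (j == i)%:R); rewrite (bigD1 i) //= mxE eqxx scale1r.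
  by rewrite big1 ?addr0 // => j ji; rewrite mxE (negPf ji) scale0r.
have /choice[c cP] : forall z, exists c : 'rV[R]_n, iota z = \sum_i c 0 i *: q i.
  by move=> z; apply/iP; exists z.
have xk0 : \sum_i tens (x 0 i) (k i) = 0.
  move/flatP: fL => /(_ _ _ iota iinj); apply=> _.
  have tm0 := tensor_map0 (idfun : {linear L -> L}) iota.
  have tmD := tensor_mapD (idfun : {linear L -> L}) iota.
  rewrite (big_morph _ tmD tm0) -[RHS]xq0; apply: eq_bigr => i _.
  by rewrite tensor_mapE kP.
pose W (z : 'rV[L]_n) := exists m (y : 'rV[L]_m) (A : 'M[R]_(m, n)),
    z = rmulmx y A /\ forall j, \sum_i A j i *: q i = 0.
have W0 : W 0.
  exists 0, 0, 0; rewrite rmulmx0; split=> // -[] //.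
have WB z z' : W z -> W z' -> W (z - z').
  move=> [m [y [A [-> Aq]]]] [m' [y' [A' [-> Aq']]]].
  exists (m + m')%N, (row_mx y (- y')), (col_mx A A').
  rewrite rmulmx_block rmulmxNl; split=> // j.
  case: (split_ordP j) => j' ->.
    by under eq_bigr => i _ do rewrite col_mxEu; apply: Aq.
  by under eq_bigr => i _ do rewrite col_mxEd; apply: Aq'.
pose b (m : L) (z : K) : 'rV[L]_n := \row_i ract m (c z 0 i).
have Wc m (d : 'rV[R]_n) : \sum_i d 0 i *: q i = 0 -> W (\row_i ract m (d 0 i)).
  move=> dq; exists 1, (const_mx m), d; split.
    by apply/rowP => i; rewrite !mxE big_ord1 mxE.
  by move=> j; rewrite ord1.
have Wrel z : tensor_rel z -> W (free_lift b z).
  elim=> [|z1 z2 _ h1 _ h2|m m' z'|m z1 z2|m a z'].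
  - by rewrite free_lift0.
  - by rewrite free_liftB; apply: WB.
  - rewrite free_liftB free_liftD !free_liftU.
    rewrite [X in W X](_ : _ = 0) //; apply/rowP => i; rewrite !mxE.
    by rewrite ractDl subrr.
  - rewrite free_liftB free_liftD !free_liftU.
    rewrite [X in W X](_ : _ = \row_i ract m ((c (z1 + z2) - (c z1 + c z2)) 0 i)).
      apply: Wc; have /eqP := cP (z1 + z2).
      rewrite raddfD /= !cP -big_split -subr_eq0 -sumrB => /eqP e.
      rewrite -[LHS]opprK -sumrN -[in RHS]oppr0 -[in RHS]e; congr (- _).
      by apply: eq_bigr => i _; rewrite !mxE scalerBl scalerDl opprB.
    by apply/rowP => i; rewrite !mxE !(ractDr, ractNr).
  - rewrite free_liftB !free_liftU.
    rewrite [X in W X](_ : _ = \row_i ract m ((a *: c z' - c (a *: z')) 0 i)).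
      apply: Wc; have /eqP := cP (a *: z').
      rewrite linearZ /= cP scaler_sumr -subr_eq0 -sumrB => /eqP e.
      rewrite -[RHS]e; apply: eq_bigr => i _.
      by rewrite !mxE scalerBl scalerA.
    by apply/rowP => i; rewrite !mxE ractDr ractNr ractA.
have relx : tensor_rel (\sum_i tgen (x 0 i) (k i)).
  have : (\sum_i tgen (x 0 i) (k i)) - 0 \in @tensor_relb R L K.
    rewrite idealrBE; apply/eqP; rewrite raddf_sum.
    by rewrite -[LHS]/(\sum_i tens (x 0 i) (k i)) xk0 raddf0.
  by rewrite subr0 => /asboolP.
move: (Wrel _ relx); rewrite (big_morph _ (free_liftD b) (free_lift0 b)) => Wb.
have WN z : W z -> W (- z) by move=> Wz; rewrite -sub0r; apply: WB.
have WD z z' : W z -> W z' -> W (z + z').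
  by move=> Wz Wz'; rewrite -[z']opprK; apply: WB => //; apply: WN.
suff Wx : W x by [].
(* The difference is a sum of rows x_i (e_i - c(k_i)), with e_i the unit row. Both e_i and c(k_i)
   express q_i, so [Wc] applies. *)
rewrite -(subrK (\sum_i free_lift b (tgen (x 0 i) (k i))) x).
apply: (WD) => //; pose e i : 'rV[R]_n := \row_l (l == i)%:R.
have xE : x = \sum_i (\row_j ract (x 0 i) (e i 0 j)).
  apply/rowP => j; rewrite summxE (bigD1 j) //= !mxE eqxx ract1.
  by rewrite big1 ?addr0 // => i ij; rewrite !mxE eq_sym (negPf ij) ractr0.
rewrite (eq_bigr (fun i => b (x 0 i) (k i))); last first.
  by move=> i _; rewrite free_liftU.
rewrite {1}xE -sumrB.
apply: (big_ind W W0 WD) => i _.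
rewrite [X in W X](_ : _ = \row_j ract (x 0 i) ((e i - c (k i)) 0 j)).
  apply: Wc; under eq_bigr => j _ do rewrite !mxE scalerBl.
  rewrite sumrB -cP kP (bigD1 i) //= eqxx scale1r big1 ?addr0 ?subrr // => j ji.
  by rewrite (negPf ji) scale0r.
by apply/rowP => j; rewrite !mxE ractDr ractNr.
Qed.

Lemma tens_rmulmx L (N : lmodType R) m n (y : 'rV[L]_m) (A : 'M[R]_(m, n))
    (q : 'I_n -> N) :
  \sum_l tens (rmulmx y A 0 l) (q l) =
  \sum_j tens (y 0 j) (\sum_l A j l *: q l).
Proof.
have [hl hr ha] := tens_balanced L N.
have lD (z : N) : {morph (fun x : L => tens x z) : x x' / x + x' >-> x + x'}.
  by move=> x x' /=; rewrite hl.
have rD (z : L) : {morph (fun x : N => tens z x) : x x' / x + x' >-> x + x'}.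
  by move=> x x' /=; rewrite hr.
under eq_bigr => l _ do rewrite mxE (big_morph _ (lD _) (tens0l _ _)).
rewrite exchange_big; apply: eq_bigr => j _.
rewrite (big_morph _ (rD _) (tens0r _ _)); apply: eq_bigr => l _; exact: ha.
Qed.

(** In the left module R, the sum of the x_i tensor r_i is (x r) tensor 1, hence zero, and
    [tens_sum_eq0] applies to the entries of r. *)
Lemma flat_eqflat L : flat L -> eqflat L.
Proof.
move=> fL n x r xr.
have := tens_rmulmx x r (fun=> 1 : R^o); rewrite big_ord1 xr mxE tens0l => /esym xr0.
have [m [y [A [xE Ar]]]] := tens_sum_eq0 fL xr0.
exists m, y, A; split=> //; apply/colP => j; rewrite !mxE -[RHS](Ar j).
by apply: eq_bigr => i _; rewrite big_ord1; congr (_ * _); apply/esym/mulr1.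
Qed.

(* Test the Mittag-Leffler property on the product, over all factorizations
   x = y' A', of the left modules R^n / (row space of A'). *)
Lemma flat_ML_stable L n (x : 'rV[L]_n) : flat_ML L ->
  exists m (y : 'rV[L]_m) (A : 'M[R]_(m, n)), x = rmulmx y A /\
    forall m' (y' : 'rV[L]_m') (A' : 'M[R]_(m', n)), x = rmulmx y' A' ->
      exists B, A = B *m A'.
Proof.
move=> [fL /mittag_lefflerP mL].
pose I := {m' : nat & {yA : 'rV[L]_m' * 'M[R]_(m', n) | x = rmulmx yA.1 yA.2}}.
have /choice[Qp QpP] : forall i : I, exists Qp : {Q : lmodType R & 'I_n -> Q},
    (forall j, \sum_l (sval (projT2 i)).2 j l *: projT2 Qp l = 0) /\
    forall c : 'rV[R]_n, \sum_l c 0 l *: projT2 Qp l = 0 ->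
      exists b, c = b *m (sval (projT2 i)).2.
  move=> [m' [[y' A'] /= xE]].
  pose N (c : 'rV[R]_n) := exists b, c = b *m A'.
  have NP : submodule N.
    split; first by exists 0; rewrite mul0mx.
    move=> a _ _ [b ->] [b' ->]; exists (a *: b + b').
    by rewrite mulmxDl scalemxAl.
  have [Q [p [_ pP]]] := quotient_exists NP.
  have pE c : p c = \sum_l c 0 l *: p (delta_mx 0 l).
    rewrite {1}[c]row_sum_delta linear_sum.
    by apply: eq_bigr => l _; rewrite linearZ_LR.
  exists (existT (fun Q : lmodType R => 'I_n -> Q) Q (fun l => p (delta_mx 0 l))).
  split=> [j|c] /=; last by rewrite -pE => /pP.
  transitivity (p (row j A')); last by apply/pP; exists (delta_mx 0 j); rewrite rowE.
  by rewrite pE; apply: eq_bigr => l _; rewrite mxE.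
pose Q i : lmodType R := projT1 (Qp i).
pose q (l : 'I_n) : prodmod Q := fun i => projT2 (Qp i) l.
have xq0 : \sum_l tens (x 0 l) (q l) = 0.
  apply: mL => i.
  have tm0 := tensor_map0 (idfun : {linear L -> L}) (@prodmod_proj R I Q i).
  have tmD := tensor_mapD (idfun : {linear L -> L}) (@prodmod_proj R I Q i).
  rewrite (big_morph _ tmD tm0).
  under eq_bigr => l _ do rewrite tensor_mapE /=.
  have [Qp0 _] := QpP i; rewrite (svalP (projT2 i)) tens_rmulmx.
  by rewrite big1 // => j _; rewrite [X in tens _ X](Qp0 j) tens0r.
have [m [y [A [xE Aq]]]] := tens_sum_eq0 fL xq0.
exists m, y, A; split=> // m' y' A' xE'.
pose i : I := existT _ m' (exist _ (y', A') xE').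
(* The component at i of the relation [Aq j] lives in R^n modulo the rows of A'; its vanishing puts
   row j of A in the row space of A'. *)
have rowB j : exists b, row j A = b *m A'.
  apply: (QpP i).2.
  have /(congr1 (fun f : prodmod Q => f i)) e := Aq j.
  rewrite -[RHS]e -[RHS]/(prodmod_proj i (\sum_l A j l *: q l)) linear_sum.
  by apply: eq_bigr => l _; rewrite mxE linearZ_LR.
have [B BP] := choice rowB; exists (\matrix_j B j).
by apply/row_matrixP => j; rewrite row_mul rowK BP.
Qed.

End RightMul.

(** * Vanishing of Ext *)

Section HomologicalLemmas.
Variable S : pzRingType.
Implicit Types A B C K M P Q X : lmodType S.

Lemma corestrict P X K (h : {linear P -> X}) (iota : {linear K -> X}) :
  injective iota -> (forall y, exists k, iota k = h y) ->
  exists h' : {linear P -> K}, forall y, iota (h' y) = h y.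
Proof.
move=> iinj hi; have [//|||h' h'P] := @lin_of_rel S P K (fun y k => iota k = h y).
- by move=> a x y x' y' e e'; rewrite !linearP e e'.
- by move=> k e; apply: iinj; rewrite e !linear0.
- by exists h' => y; apply/h'P.
Qed.

(** Here q need not be onto: both maps corestrict to its image. *)
Lemma projective_lift P Q X (q : {linear Q -> X}) (h : {linear P -> X}) :
  projective P -> (forall y, exists z, q z = h y) ->
  exists l : {linear P -> Q}, forall y, q (l y) = h y.
Proof.
move=> prP qh; have NP : submodule (fun x => exists z, q z = x).
  split; first by exists 0; rewrite linear0.
  by move=> a _ _ [z <-] [z' <-]; exists (a *: z + z'); rewrite linearP.
have [K [iota [iinj iP]]] := submodule_exists NP.
have [|q' q'P] := corestrict (h := q) iinj.
  by move=> z; apply/iP; exists z.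
have [|h' h'P] := corestrict (h := h) iinj.
  by move=> y; apply/iP.
have [|l lP] := prP _ _ q' h'; last by exists l => y; rewrite -q'P lP.
move=> k; have /iP[z qz] : exists k', iota k' = iota k by exists k.
by exists z; apply: iinj; rewrite q'P.
Qed.

Lemma projective_regular : projective (S^o : lmodType S).
Proof.
move=> A B p f sp; have [a pa] := sp (f 1).
have al : linear (fun x : S^o => (x : S) *: a).
  by move=> c x y; rewrite scalerDl scalerA.
pose h : {linear S^o -> A} := HB.pack (fun x : S^o => (x : S) *: a)
  (GRing.isLinear.Build _ _ _ _ _ al).
exists h => x; rewrite -[h x]/((x : S) *: a) linearZ_LR pa -linearZ_LR.
by congr (f _); apply: mulr1.
Qed.

Lemma projective_dsum (I : eqType) (F : I -> lmodType S) D inj proj :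
  @is_dsum S I F D inj proj -> (forall i, projective (F i)) -> projective D.
Proof.
move=> HD prF A B p f sp.
have lift i : exists h : {linear F i -> A}, forall x, p (h x) = f (inj i x).
  exact: (prF i _ _ p (f \o inj i) sp).
pose h i := sval (cid (lift i)).
have [g gP] := dsum_lift HD h; exists g.
apply: (dsum_ind HD) => [|x y hx hy|i x]; first by rewrite !linear0.
  by rewrite !linearD hx hy.
by rewrite gP; apply: (svalP (cid (lift i))).
Qed.

Lemma free_cover C : exists (D : lmodType S) inj proj (p : {linear D -> C}),
  @is_dsum S C (fun=> S^o) D inj proj /\ forall c, exists x, p x = c.
Proof.
have [D [inj [proj HD]]] := @dsum_exists S C (fun=> S^o).
have gl (c : C) : linear (fun x : S^o => (x : S) *: c).
  by move=> a x y; rewrite scalerDl scalerA.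
pose g c : {linear S^o -> C} := HB.pack (fun x : S^o => (x : S) *: c)
  (GRing.isLinear.Build _ _ _ _ _ (gl c)).
have [p pP] := dsum_lift HD g.
exists D, inj, proj, p; split=> // c; exists (inj c (1 : S)).
by rewrite pP; apply: scale1r.
Qed.

Lemma projective_cover C : exists P (p : {linear P -> C}),
  projective P /\ forall c, exists x, p x = c.
Proof.
have [D [inj [proj [p [HD sp]]]]] := free_cover C.
exists D, p; split=> //; apply: (projective_dsum HD) => _.
exact: projective_regular.
Qed.

Lemma kernel_exists A B (f : {linear A -> B}) : exists K (i : {linear K -> A}),
  injective i /\ forall x, f x = 0 <-> exists k, i k = x.
Proof.
apply: submodule_exists; split=> [|a x y fx fy]; first exact: linear0.
by rewrite linearP fx fy scaler0 addr0.
Qed.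

Lemma projective_cover_kernel A B (f : {linear A -> B}) :
  exists P (g : {linear P -> A}),
    projective P /\ forall x, f x = 0 <-> exists y, g y = x.
Proof.
have [K [i [_ iP]]] := kernel_exists f.
have [P [p [prP sp]]] := projective_cover K.
exists P, (i \o p); split=> // x; split=> [/iP[k <-]|[y <-]].
  by have [y <-] := sp k; exists y.
by apply/iP; exists (p y).
Qed.

Lemma proj_resolution_exists C : exists _ : proj_resolution C, True.
Proof.
have [P0 [aug [prP0 saug]]] := projective_cover C.
have [P1 [d0 [prP1 ex0]]] := projective_cover_kernel aug.
(* A state is one differential with its source and target. The next one covers its kernel, so
   consecutive differentials share an object definitionally. *)
pose T := {A : lmodType S & {B : lmodType S & {linear A -> B}}}.
pose cov (t : T) := cid (projective_cover_kernel (projT2 (projT2 t))).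
pose next (t : T) : T :=
  existT _ (sval (cov t)) (existT _ (projT1 t) (sval (cid (svalP (cov t))))).
pose st n := iter n next (existT _ P1 (existT _ P0 d0) : T).
pose ob n : lmodType S := projT1 (projT2 (st n)).
pose d n : {linear ob n.+1 -> ob n} := projT2 (projT2 (st n)).
have prst n : projective (projT1 (st n)).
  by case: n => [|n] //=; have [] := svalP (cid (svalP (cov (st n)))).
have prob n : projective (ob n) by case: n => [|n]; [exact: prP0 | exact: prst].
have ex n x : d n x = 0 <-> exists y, d n.+1 y = x.
  by have [_] := svalP (cid (svalP (cov (st n)))); apply.
by exists (@ProjResolution S C ob d aug prob saug ex0 ex).
Qed.

(** The map f stands for a homomorphism from the kernel of p to M, presented through a map q onto
    that kernel. A differential of a resolution and a kernel inclusion can both serve as q. *)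
Definition extends_along C M : Prop :=
  forall X Q (p : {linear X -> C}) (q : {linear Q -> X}) (f : {linear Q -> M}),
    (forall c, exists x, p x = c) -> (forall x, p x = 0 <-> exists z, q z = x) ->
    (forall z, q z = 0 -> f z = 0) ->
    exists g : {linear X -> M}, forall z, g (q z) = f z.

(** A resolution is one instance of p and q. Conversely, lifting a resolution of C to a0 and a1
    turns f into a cocycle f a1; its primitive g0 is glued with f along X = a0(P_0) + q(Q). *)
Lemma Ext1_eq0P C M : Ext1_eq0 C M <-> extends_along C M.
Proof.
split=> [E X Q p q f sp kp kq | E P f fd]; last first.
  have [||z qz|g gP] := E _ _ (res_aug P) (res_d P 0) f.
  - exact: res_aug_surj.
  - exact: res_exact0.
  - by have /res_exact[y <-] := qz.
  - by exists g.
have [P _] := proj_resolution_exists C.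
have [|a0 a0P] := projective_lift (q := p) (h := res_aug P) (@res_proj _ _ P 0).
  by move=> y; apply: sp.
have [|a1 a1P] := projective_lift (q := q) (h := a0 \o res_d P 0)
    (@res_proj _ _ P 1).
  by move=> y /=; apply/kp; rewrite a0P; apply/(@res_exact0 _ _ P); exists y.
have [|g0 g0P] := E P (f \o a1).
  move=> x /=; apply: kq; rewrite a1P /=.
  have -> : res_d P 0 (res_d P 1 x) = 0 by apply/res_exact; exists x.
  by rewrite linear0.
pose G x m := exists y z, x = a0 y + q z /\ m = g0 y + f z.
have [||m|g gP] := @lin_of_rel S X M G.
- move=> x; have [y py] := @res_aug_surj _ _ P (p x).
  have /kp[z qz] : p (x - a0 y) = 0 by rewrite linearB a0P py subrr.
  by exists (g0 y + f z), y, z; rewrite qz addrC subrK.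
- move=> a x m x' m' [y [z [-> ->]]] [y' [z' [-> ->]]].
  exists (a *: y + y'), (a *: z + z'); rewrite !linearP.
  by rewrite !scalerDr; split; rewrite addrACA.
- move=> [y [z [e ->]]].
  have /(@res_exact0 _ _ P)[w dw] : res_aug P y = 0.
    rewrite -a0P -[a0 y](addrK (q z)) -e sub0r linearN.
    by have -> : p (q z) = 0 by [apply/kp; exists z]; rewrite oppr0.
  have : q (a1 w + z) = 0 by rewrite linearD a1P /= dw -e.
  by move/kq; rewrite linearD -dw -g0P.
- exists g => z; apply/esym/gP; exists 0, z.
  by rewrite !linear0 !add0r.
Qed.

Lemma projective_Ext1 C M : projective C -> Ext1_eq0 C M.
Proof.
move=> prC; apply/Ext1_eq0P => X Q p q f sp kp kq.
have [s sP] := prC _ _ p (idfun : {linear C -> C}) sp.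
have [||m|r rP] := @lin_of_rel S X M
  (fun x m => exists z, q z = x - s (p x) /\ f z = m).
- move=> x; have /kp[z qz] : p (x - s (p x)) = 0 by rewrite linearB sP subrr.
  by exists (f z), z.
- move=> a x m x' m' [z [qz <-]] [z' [qz' <-]]; exists (a *: z + z').
  split; last by rewrite linearP.
  by rewrite linearP qz qz' (linearP p) (linearP s) scalerBr opprD addrACA.
- by move=> [z []]; rewrite (linear0 p) (linear0 s) subrr => /kq -> <-.
have srel x : exists z, q z = x - s (p x) /\ f z = r x by apply/rP.
exists r => z; have [z' [qz' <-]] := srel (q z).
have pq0 : p (q z) = 0 by apply/kp; exists z.
apply/eqP; rewrite -subr_eq0 -linearB; apply/eqP/kq.
by rewrite linearB qz' pq0 (linear0 s) subr0 subrr.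
Qed.

(** The identity of the kernel of a map from a projective module onto C extends to that module, so
    the map splits. *)
Lemma Ext1_projective C : (forall M, Ext1_eq0 C M) -> projective C.
Proof.
move=> E; have [P [p [prP sp]]] := projective_cover C.
have [K [i [iinj iP]]] := kernel_exists p.
have [|g gP] := (Ext1_eq0P C K).1 (E K) _ _ p i idfun sp iP.
  by move=> z; rewrite -(linear0 i) => /iinj.
have [|s sP] := factor_surj (p := p)
  (f := (idfun : {linear P -> P}) \- (i \o g)) sp.
  by move=> x /iP[k <-] /=; rewrite gP subrr.
move=> A B a b sa; have [h hP] := prP _ _ a (b \o p) sa.
exists (h \o s) => c /=; rewrite hP /=; congr (b _).
have [x <-] := sp c; rewrite sP /= linearB.
by have -> : p (i (g x)) = 0 by [apply/iP; exists (g x)]; rewrite subr0.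
Qed.

End HomologicalLemmas.

(** * Tree modules *)

Section TreeModule.
Variables (R : pzRingType) (F : nat -> rmodType R).
Variable u : forall n, {linear F n -> F n.+1}.
Variables (T : nat -> Type) (B : eqType) (res : B -> forall n, T n).
Hypothesis res_sep : forall b b', b != b' ->
  exists N, forall n, (N <= n)%N -> res b n <> res b' n.

Let I := {classic ({n & T n} + B * nat)%type}.
Let lev (i : I) : nat :=
  match (i : ({n & T n} + B * nat)%type) with inl s => projT1 s | inr c => c.2 end.

Definition tree_module (E : rmodType R) (d : forall n, T n -> {linear F n -> E})
    (br : B -> forall n, {linear F n -> E}) : Prop :=
  [/\ forall b n x, br b n x = d n (res b n) x + br b n.+1 (u n x),
      forall (Y : rmodType R) (a : forall n, T n -> {linear F n -> Y})
        (c : B -> forall n, {linear F n -> Y}),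
        (forall b n x, c b n x = a n (res b n) x + c b n.+1 (u n x)) ->
        exists h : {linear E -> Y}, (forall n s x, h (d n s x) = a n s x) /\
          forall b n x, h (br b n x) = c b n x
    & forall P : E -> Prop, P 0 -> (forall x y, P x -> P y -> P (x + y)) ->
        (forall n s x, P (d n s x)) -> (forall b n x, P (br b n x)) ->
        forall e, P e].

Lemma tree_module_exists : exists E d br, @tree_module E d br.
Proof.
have [D [inj [proj HD]]] := dsum_exists (fun i : I => F (lev i)).
pose d0 n (s : T n) : {linear F n -> D} := inj (inl (existT _ n s)).
pose br0 b n : {linear F n -> D} := inj (inr (b, n)).
(* The submodule generated by the relations, as the common kernel of all homomorphisms that respect
   them. *)
pose N (y : D) := forall (Y : rmodType R) (h : {linear D -> Y}),
  (forall b n x, h (br0 b n x) = h (d0 n (res b n) x) + h (br0 b n.+1 (u n x))) ->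
  h y = 0.
have NP : submodule N.
  split=> [Y h _|a x y Nx Ny Y h hP]; first exact: linear0.
  by rewrite linearP Nx ?Ny // scaler0 addr0.
have [E [p [sp pP]]] := quotient_exists NP.
exists E, (fun n s => p \o d0 n s), (fun b n => p \o br0 b n); split.
- move=> b n x /=; rewrite -linearD; apply/eqP; rewrite -subr_eq0 -linearB.
  by apply/eqP/pP => Y h hP; rewrite linearB linearD hP subrr.
- move=> Y a c ac.
  pose g (i : I) : {linear F (lev i) -> Y} :=
    match i return {linear F (lev i) -> Y} with
    | inl s => a (projT1 s) (projT2 s) | inr bn => c bn.1 bn.2 end.
  have [h0 h0P] := dsum_lift HD g.
  have h0d n s x : h0 (d0 n s x) = a n s x by apply: (h0P (inl (existT _ n s))).
  have h0b b n x : h0 (br0 b n x) = c b n x by apply: (h0P (inr (b, n))).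
  have [|h hP] := factor_surj (f := h0) sp.
    by move=> x /pP; apply=> b n z; rewrite !h0b h0d; apply: ac.
  by exists h; split=> [n s|b n] x /=; rewrite hP.
- move=> P P0 PD Pd Pb e; have [x <-] := sp e.
  elim/(dsum_ind HD): x => [|x y Px Py|[[n s]|[b n]] x].
  + by rewrite linear0.
  + by rewrite linearD; apply: PD.
  + exact: Pd.
  + exact: Pb.
Qed.

(* Finitely many elements of E involve a finite set S of branches, which are
   pairwise distinct at some height N; they are fixed by the retraction that
   truncates at height N and then prolongs along the branches of S. *)
Lemma flat_ML_tree E d br : @tree_module E d br ->
  (forall n, flat_ML (F n)) -> flat_ML E.
Proof.
move=> [Erel Euniv Egen] FML.
pose J := {classic {n & T n}}.
have [D [inj [proj HD]]] := dsum_exists (fun j : J => F (projT1 j)).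
have DML : flat_ML D by apply: (flat_ML_dsum HD).
pose dD n (s : T n) : {linear F n -> D} := inj (existT _ n s).
(* [w j b n] collects j consecutive nodes of b from height n on. Truncation at N keeps the heights n
   to N, which are N+1-n in number, and none if n > N. *)
pose w := fix w j b n : {linear F n -> D} :=
  if j is j'.+1 then dD n (res b n) \+ (w j' b n.+1 \o u n) else \0.
have a_exists N : exists a : {linear E -> D},
    (forall n s x, a (d n s x) = if (n <= N)%N then dD n s x else 0) /\
    forall b n x, a (br b n x) = w (N.+1 - n)%N b n x.
  have [|a [ad ab]] := Euniv D
    (fun n s => if (n <= N)%N then dD n s else \0)
    (fun b n => w (N.+1 - n)%N b n).
    move=> b n x; case: leqP => [nN|Nn].
      by rewrite subSS subSn.
    by rewrite (eqP Nn) subSS (eqP (ltnW Nn)) addr0.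
  by exists a; split=> // n s x; rewrite ad; case: ifP.
(* Nodes at the cutting height N on a branch of S; the way back sends them to the rest of a branch
   chosen by [cid], which is the right one once N separates S. *)
pose hit (S : seq B) N n (s : T n) := exists b, [/\ b \in S, n = N & res b n = s].
have b_exists S N : exists c : {linear D -> E}, forall n s x,
    c (dD n s x) = if pselect (hit S N n s) is left h then br (sval (cid h)) n x
                   else d n s x.
  have [c cP] := dsum_lift HD (fun j : J =>
    if pselect (hit S N (projT1 j) (projT2 j)) is left h
    then br (sval (cid h)) (projT1 j) else d (projT1 j) (projT2 j)).
  by exists c => n s x; have := cP (existT _ n s) x; case: pselect.
have [a aP] := choice a_exists.
pose c S N := sval (cid (b_exists S N)).
have cP S N n s x : c S N (dD n s x) = if pselect (hit S N n s) is left h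
    then br (sval (cid h)) n x else d n s x := svalP (cid (b_exists S N)) n s x.
pose sepat (S : seq B) N := {in S &, injective (fun b => res b N)}.
have sep_exists S N0 : exists2 N, (N0 <= N)%N & sepat S N.
  have /choice[m mP] : forall bb : B * B, exists N, bb.1 != bb.2 ->
      forall n, (N <= n)%N -> res bb.1 n <> res bb.2 n.
    move=> bb; case: (eqVneq bb.1 bb.2) => [_|/res_sep[N NP]]; first by exists 0.
    by exists N.
  exists (maxn N0 (\max_(b <- S) \max_(b' <- S) m (b, b'))); first exact: leq_maxl.
  move=> b b' bS b'S /= e; apply: contraPeq e => /(mP (b, b')); apply.
  apply: leq_trans (leq_maxr _ _).
  rewrite (big_rem _ bS) leq_max (big_rem _ b'S) leq_max leqnn //.
pose loc (e : E) := exists (S : seq B) N0, forall (S' : seq B) N,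
  {subset S <= S'} -> (N0 <= N)%N -> sepat S' N -> c S' N (a N e) = e.
have locE e : loc e.
  elim/Egen: e => [|x y [S1 [N1 h1]] [S2 [N2 h2]]|n s x|b n x].
  - by exists [::], 0 => S' N _ _ _; rewrite !linear0.
  - exists (S1 ++ S2), (maxn N1 N2) => S' N sS; rewrite geq_max => /andP[l1 l2] sp.
    rewrite !linearD h1 ?h2 // => b bS; apply: sS; rewrite mem_cat bS ?orbT //.
  (* With N > n the node lies below the cutting height and is sent back to itself. *)
  - exists [::], n.+1 => S' N _ nN _; rewrite (aP N).1 (ltnW nN) cP.
    by case: pselect => // h; have [b [_ nE _]] := h; rewrite nE ltnn in nN.
  - exists [:: b], n => S' N sS nN sp.
    have bS : b \in S' by apply: sS; rewrite inE.
    rewrite (aP N).2 subSn //; have := subnKC nN; move: (N - n)%N => j.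
    (* Induction on the distance from n to the cutting height; at distance 0 the node is hit and
       returns the rest of the branch. *)
    elim: j n x {nN} => [|j IH] n x njN /=; rewrite linearD cP.
      rewrite linear0 addr0; case: pselect => [h|[]]; last first.
        by exists b; rewrite -njN addn0.
      have [b'S _ rb'] := svalP (cid h); move: (sval _) b'S rb' => b' b'S rb'.
      congr (br _ n x).
      by apply: sp => //; rewrite -njN addn0.
    case: pselect => [h|_].
      have [b' [_ nE _]] := h.
      exfalso; move: njN; rewrite nE => /eqP.
      by rewrite -[X in _ == X]addn0 eqn_add2l.
    by rewrite IH ?addSnnS // -Erel.
apply: flat_ML_local => es.
have [S [N0 SP]] : exists (S : seq B) N0, forall (S' : seq B) N,
    {subset S <= S'} -> (N0 <= N)%N -> sepat S' N -> {in es, cancel (a N) (c S' N)}.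
  elim: es => [|e es [S [N0 IH]]]; first by exists [::], 0.
  have [S1 [N1 h1]] := locE e; exists (S1 ++ S), (maxn N1 N0) => S' N sS.
  rewrite geq_max => /andP[l1 l2] sp e'; rewrite inE => /predU1P[->|].
    by apply: h1 => // b bS; apply: sS; rewrite mem_cat bS.
  by apply: IH => // b bS; apply: sS; rewrite mem_cat bS orbT.
have [N N0N sp] := sep_exists S N0.
by exists D, (a N), (c S N); split=> //; apply: SP.
Qed.

End TreeModule.

(** * The tree of homomorphisms and the diagonal argument *)

Section Splitting.
Variables (R : pzRingType) (F : nat -> rmodType R).
Variables (u : forall n, {linear F n -> F n.+1}) (A : rmodType R).

Fixpoint hom_tree n : Type :=
  if n is n'.+1 then (hom_tree n' * (hom_tree n' -> {linear F n' -> A}))%type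
  else unit.

Definition hom_branch : Type := forall n, hom_tree n -> {linear F n -> A}.

Fixpoint branch_node (b : hom_branch) n : hom_tree n :=
  match n return hom_tree n with
  | 0 => tt
  | n'.+1 => (branch_node b n', b n')
  end.
(** Nodes contain their ancestors, so branches that differ at height k have distinct nodes at every
    height above k. *)
Lemma branch_node_sep (b b' : {classic hom_branch}) : b != b' ->
  exists N, forall n, (N <= n)%N -> branch_node b n <> branch_node b' n.
Proof.
move=> bb'; have [k bk] : exists k, b k <> b' k.
  apply: contrapT => /forallNP bk; move/eqP: bb'; apply.
  by apply/functional_extensionality_dep => k; apply: contrapT.
exists k.+1 => n; elim: n => // n IH; rewrite ltnS leq_eqVlt => /predU1P[<-|kn].
  by case=> _ /bk.
by case=> e _; apply: IH e.
Qed.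

(* The diagonal argument: S is the set of branches b for which the homomorphisms
   prescribed by b along b itself extend to the copy of the chain at b with zero
   image in L. *)
Lemma direct_limit_split (L : rmodType R) (v : forall n, {linear F n -> L})
    (f : {linear A -> L}) :
  (forall n, flat_ML (F n)) -> is_direct_limit u v ->
  (forall (E : rmodType R) (h : {linear E -> L}), flat_ML E ->
     exists g : {linear E -> A}, forall x, f (g x) = h x) ->
  exists s : {linear L -> A}, forall x, f (s x) = x.
Proof.
move=> FML [vu vuniv] lift.
have [E [d [br EP]]] := tree_module_exists u (T := hom_tree)
  (B := {classic hom_branch}) branch_node.
have EML := flat_ML_tree branch_node_sep EP FML.
have [Erel Euniv _] := EP.
pose S (b : hom_branch) := exists g : forall n, {linear F n -> A},
  (forall n x, g n x = b n (branch_node b n) x + g n.+1 (u n x)) /\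
  forall n x, f (g n x) = 0.
(* The map h kills the node copies and is v on the branches in S, zero on the others. *)
have [|h [hd hb]] := Euniv L (fun n s => \0)
  (fun b n => if pselect (S b) then v n else \0).
  by move=> b n x; case: pselect => _ //=; rewrite add0r ?vu.
have [g gP] := lift E h EML.
pose b : hom_branch := fun n s => g \o d n s.
have grel n x : g (br b n x) = b n (branch_node b n) x + g (br b n.+1 (u n x)).
  by rewrite Erel linearD.
have fg n x : f (g (br b n x)) = if pselect (S b) then v n x else 0.
  by rewrite gP hb; case: pselect.
(* If b were outside S, the maps [g \o br b n] would have zero image in L and so put b in S. *)
have Sb : S b.
  apply: contrapT => nS; apply: (nS); exists (fun n => g \o br b n).
  by split=> n x //=; rewrite fg; case: pselect.
have {}fg n x : f (g (br b n x)) = v n x by rewrite fg; case: pselect.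
have [g' [g'rel fg']] := Sb.
(* Both families satisfy the relation along b, so their difference is compatible with u; f sends it
   to v because f g' = 0. *)
pose w n : {linear F n -> A} := (g \o br b n) \- g' n.
have [|s [sw _]] := vuniv A w.
  by move=> n x; rewrite /w /= (grel n) (g'rel n) opprD addrACA subrr add0r.
have [h' [_ h'u]] := vuniv L v vu.
exists s => x; rewrite -[LHS]/((f \o s) x) h'u => [|n z].
  by rewrite -(h'u idfun).
by rewrite /= sw /w /= linearB fg fg' subr0.
Qed.

End Splitting.

(** * Extensions: splitting and lifting *)

Section Extensions.
Variable S : pzRingType.
Implicit Types C E L M X : lmodType S.

Definition short_exact M X C (i : {linear M -> X}) (p : {linear X -> C}) : Prop :=
  [/\ injective i, forall c, exists x, p x = c
    & forall x, p x = 0 <-> exists m, i m = x].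

(** X is the pushout of [res_d P 0] along f, an extension of C by M because f is a cocycle. For a
    section s, the map j0 - s aug lands in M and agrees with f on boundaries. *)
Lemma Ext1_eq0_split C M :
  (forall X (i : {linear M -> X}) (p : {linear X -> C}), short_exact i p ->
     exists s : {linear C -> X}, forall c, p (s c) = c) ->
  Ext1_eq0 C M.
Proof.
move=> splitC P f fd; pose N (x : res_obj P 0 * M) :=
  exists z, x.1 = res_d P 0 z /\ x.2 = - f z.
have NP : submodule N.
  split; first by exists 0; rewrite !linear0.
  move=> a [x1 x2] [y1 y2] [z [/= -> ->]] [z' [/= -> ->]]; exists (a *: z + z').
  by rewrite /= linearP (linearP f) opprD scalerN.
have [X [q [sq qP]]] := quotient_exists NP.
have jl : linear (fun m : M => q (0, m)).
  move=> a m m'; rewrite -linearP; congr (q _).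
  by apply: injective_projections; rewrite /= ?scaler0 ?addr0.
pose j : {linear M -> X} := HB.pack (fun m : M => q (0, m))
  (GRing.isLinear.Build _ _ _ _ _ jl).
have j0l : linear (fun x : res_obj P 0 => q (x, 0)).
  move=> a x x'; rewrite -linearP; congr (q _).
  by apply: injective_projections; rewrite /= ?scaler0 ?addr0.
pose j0 : {linear res_obj P 0 -> X} := HB.pack (fun x : res_obj P 0 => q (x, 0))
  (GRing.isLinear.Build _ _ _ _ _ j0l).
have qE x m : q (x, m) = j0 x + j m.
  by rewrite -[RHS]/(q _ + q _) -linearD; congr (q (_, _)); rewrite ?addr0 ?add0r.
have jd z : j0 (res_d P 0 z) = j (f z).
  apply/eqP; rewrite -subr_eq0 -linearN -qE; apply/eqP/qP.
  by exists z.
have augl : linear (fun x : res_obj P 0 * M => res_aug P x.1).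
  by move=> a x y /=; rewrite linearP.
pose aug : {linear (res_obj P 0 * M)%type -> C} :=
  HB.pack (fun x : res_obj P 0 * M => res_aug P x.1)
    (GRing.isLinear.Build _ _ _ _ _ augl).
have [|p pP] := factor_surj (f := aug) sq.
  move=> x /qP[z [xz _]]; rewrite -[LHS]/(res_aug P x.1) xz.
  by apply/res_exact0; exists z.
have pj x : p (j0 x) = res_aug P x by rewrite -[j0 x]/(q (x, 0)) pP.
have pjm m : p (j m) = 0 by rewrite -[j m]/(q (0, m)) pP; apply: linear0.
have jinj : injective j.
  move=> m m' /eqP; rewrite -subr_eq0 -linearB => /eqP/qP[z /= [/esym dz mE]].
  have /res_exact[w dw] := dz.
  by move: mE; rewrite -dw fd oppr0 => /eqP; rewrite subr_eq0 => /eqP.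
have pex x : p x = 0 <-> exists m, j m = x.
  split=> [|[m <-]]; last exact: pjm.
  have [[y m] <-] := sq x; rewrite qE linearD pj pjm addr0 => /res_exact0[z <-].
  by exists (f z + m); rewrite linearD jd.
have [|s sP] := splitC X j p.
  split=> // c; have [y yc] := res_aug_surj P c; by exists (j0 y); rewrite pj.
have [|g gP] := corestrict (h := j0 \- (s \o res_aug P)) jinj.
  by move=> y; apply/pex; rewrite /= linearB pj sP subrr.
exists g => z; apply: jinj; rewrite gP.
rewrite -[RHS]/(j0 (res_d P 0 z) - s (res_aug P (res_d P 0 z))) jd.
have -> : res_aug P (res_d P 0 z) = 0 by apply/res_exact0; exists z.
by rewrite linear0 subr0.
Qed.

(** Y is the pullback of the extension along h. Extending the identity of M gives a retraction of Y
    onto M; subtracting it from the projection to X leaves a map depending only on the component in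
    E. *)
Lemma Ext1_eq0_lift E M X L (i : {linear M -> X}) (p : {linear X -> L})
    (h : {linear E -> L}) : Ext1_eq0 E M -> short_exact i p ->
  exists g : {linear E -> X}, forall e, p (g e) = h e.
Proof.
move=> /Ext1_eq0P ext [iinj sp pP].
have pi m : p (i m) = 0 by apply/pP; exists m.
pose N (y : E * X) := h y.1 = p y.2.
have NP : submodule N.
  split; first by rewrite /N !linear0.
  by move=> a x y hx hy; rewrite /N /= !linearP hx hy.
have [Y [y [yinj yP]]] := submodule_exists NP.
have y1l : linear (fun z : Y => (y z).1) by move=> a z z'; rewrite linearP.
pose y1 : {linear Y -> E} := HB.pack (fun z : Y => (y z).1)
  (GRing.isLinear.Build _ _ _ _ _ y1l).
have y2l : linear (fun z : Y => (y z).2) by move=> a z z'; rewrite linearP.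
pose y2 : {linear Y -> X} := HB.pack (fun z : Y => (y z).2)
  (GRing.isLinear.Build _ _ _ _ _ y2l).
have hy z : h (y1 z) = p (y2 z) by apply/(yP (y z)); exists z.
have yex e x : h e = p x -> exists z, y1 z = e /\ y2 z = x.
  move=> ex; have /yP[z yz] : N (e, x) by [].
  by exists z; rewrite -[y1 z]/(y z).1 -[y2 z]/(y z).2 yz.
have ql : linear (fun m : M => (0 : E, i m)).
  move=> a m m'; rewrite linearP.
  by apply: injective_projections; rewrite /= ?scaler0 ?addr0.
pose q0 : {linear M -> (E * X)%type} := HB.pack (fun m : M => (0 : E, i m))
  (GRing.isLinear.Build _ _ _ _ _ ql).
have [|q qP] := corestrict (h := q0) yinj.
  by move=> m; apply/yP; rewrite /N /= linear0 pi.
have [||z|g gP] := ext _ _ y1 q idfun.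
- move=> e; have [x px] := sp (h e); have [z [<- _]] := yex e x (esym px).
  by exists z.
- move=> z; split=> [z1|[m <-]]; last by rewrite -[LHS]/(y (q m)).1 qP.
  have /pP[m im] : p (y2 z) = 0 by rewrite -hy z1 linear0.
  exists m; apply: yinj; rewrite qP -[LHS]/(0, i m) im -z1.
  by rewrite -[y1 z]/(y z).1 -[y2 z]/(y z).2 -surjective_pairing.
- move=> qz; apply: iinj; rewrite linear0.
  by rewrite -[LHS]/((q0 z).2) -qP qz linear0.
have [||x|s sP] := @lin_of_rel S E X
  (fun e x => exists z, y1 z = e /\ x = y2 z - i (g z)).
- move=> e; have [x px] := sp (h e); have [z [z1 _]] := yex e x (esym px).
  by exists (y2 z - i (g z)), z.
- move=> a e x e' x' [z [<- ->]] [z' [<- ->]]; exists (a *: z + z').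
  rewrite linearP (linearP y2) (linearP g) (linearP i); split=> //.
  by rewrite scalerBr opprD addrACA.
- move=> [z [z1 ->]]; have /pP[m im] : p (y2 z) = 0 by rewrite -hy z1 linear0.
  have -> : z = q m.
    apply: yinj; rewrite qP -[RHS]/(0, i m) im -z1.
    by rewrite -[y1 z]/(y z).1 -[y2 z]/(y z).2 -surjective_pairing.
  by rewrite gP -[y2 _]/(y (q m)).2 qP subrr.
exists s => e; have [z [<- ->]] := (sP e (s e)).2 erefl.
by rewrite linearB pi subr0 hy.
Qed.

End Extensions.

Lemma direct_limit_left_perp (R : pzRingType) (F : nat -> rmodType R)
    (u : forall n, {linear F n -> F n.+1}) (L : rmodType R)
    (v : forall n, {linear F n -> L}) :
  (forall n, flat_ML (F n)) -> is_direct_limit u v ->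
  left_perp (right_perp (@flat_ML R)) L.
Proof.
move=> FML lim M MP; apply: Ext1_eq0_split => X i p ex.
apply: (direct_limit_split FML lim) => E h EML.
exact: Ext1_eq0_lift (MP E EML) ex.
Qed.

(** * Countable flat modules *)

Lemma countable_enum (T : Type) (t0 : T) : countable [set: T] ->
  exists e : nat -> T, forall t, exists n, e n = t.
Proof.
move=> /countable_injP[f finj].
pose e n := if pselect (exists t, f t = n) is left h then sval (cid h) else t0.
exists e => t; exists (f t); rewrite /e; case: pselect => [h|[]]; last by exists t.
by apply: finj; rewrite ?in_setT //; apply: (svalP (cid h)).
Qed.

(** Schedules each element of the m-th module at a stage k >= m. The pair is decoded from k+1 = 2^m
    (2j+1), and m < 2^m. *)
Lemma pair_enum (T : Type) (e : nat -> T) : (forall t, exists n, e n = t) ->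
  exists d : nat -> nat * T, forall m t, exists k, (m <= k)%N /\ d k = (m, t).
Proof.
move=> eP; exists (fun k => (logn 2 k.+1, e ((k.+1 %/ 2 ^ logn 2 k.+1)./2))) => m t.
have [j <-] := eP t; exists (2 ^ m * j.*2.+1).-1.
have pos : (0 < 2 ^ m * j.*2.+1)%N by rewrite muln_gt0 expn_gt0.
rewrite prednK // lognM ?expn_gt0 // pfactorK // logn_coprime; last first.
  by rewrite coprime2n /= odd_double.
rewrite addn0 mulKn ?expn_gt0 //= uphalf_double; split=> //.
rewrite -ltnS prednK // (leq_trans (ltn_expl m (isT : 1 < 2)%N)) //.
exact: leq_pmulr.
Qed.

(** As v 0 is onto, a cocone is determined by w 0. Testing kernels against all cocones avoids naming
    the stage at which an element dies. *)
Lemma is_direct_limit_surj (S : pzRingType) (F : nat -> lmodType S)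
    (u : forall n, {linear F n -> F n.+1}) (L : lmodType S)
    (v : forall n, {linear F n -> L}) :
  (forall n x, v n.+1 (u n x) = v n x) -> (forall y, exists x, v 0 x = y) ->
  (forall n x, v n x = 0 ->
     forall (X : lmodType S) (w : forall n, {linear F n -> X}),
     (forall n x, w n.+1 (u n x) = w n x) -> w n x = 0) ->
  is_direct_limit u v.
Proof.
move=> vu v0 vker; split=> // X w wu.
have [h hP] := factor_surj (f := w 0) v0 (fun x vx => vker 0 x vx X w wu).
exists h; split=> [n x|h' h'P y]; last by have [x <-] := v0 y; rewrite h'P hP.
have [x0 x0P] : exists x0, v 0 x0 = v n x by apply: v0.
(* x' is the image of x0 in F n, so x' - x lies in the kernel of v n. *)
have [x' [vx' wx']] : exists x', v n x' = v n x /\ w n x' = w 0 x0.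
  elim: n x x0P => [|n IH] x x0P; first by exists x0.
  have [x1 x1P] : exists x1, v 0 x1 = v n.+1 x by apply: v0.
  have aux k : exists z, v k z = v 0 x0 /\ w k z = w 0 x0.
    elim: k => [|k [z [vz wz]]]; first by exists x0.
    by exists (u k z); rewrite vu wu.
  by have [z [vz wz]] := aux n.+1; exists z; rewrite vz.
rewrite -x0P hP -wx'; apply/eqP; rewrite eq_sym -subr_eq0 -linearB; apply/eqP.
by apply: vker => //; rewrite linearB vx' subrr.
Qed.

Section CountableFree.
Variables (R : pzRingType) (D : rmodType R).
Variables (inj : forall i : nat, {linear (R^c)^o -> D})
  (proj : forall i : nat, {linear D -> (R^c)^o}).
Hypothesis HD : @is_dsum _ nat (fun=> (R^c)^o) D inj proj.

Let e i : D := inj i (1 : R).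
Let row_e n : 'rV[D]_n := \row_i e i.

Let injE i (a : R) : inj i a = ract (e i) a.
Proof. by rewrite /ract -linearZ_LR; congr (inj i _); exact: (esym (@mul1r R a)). Qed.

Lemma free_lift_basis (L : rmodType R) (x : nat -> L) :
  exists h : {linear D -> L}, forall i, h (inj i (1 : R)) = x i.
Proof.
have gl i : linear (fun a : (R^c)^o => ract (x i) (a : R)).
  by move=> a b c; rewrite /ract scalerDl scalerA.
pose g i : {linear (R^c)^o -> L} := HB.pack (fun a : (R^c)^o => ract (x i) (a : R))
  (GRing.isLinear.Build _ _ _ _ _ (gl i)).
by have [h hP] := dsum_lift HD g; exists h => i; rewrite hP; apply: ract1.
Qed.

Lemma free_decomp (d : D) :
  exists n (r : 'cV[R]_n), d = rmulmx (\row_i inj i (1 : R)) r 0 0.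
Proof.
have [s us ->] := dsum_decomp HD d.
pose n := (\max_(i <- s) i.+1)%N.
have sn i : i \in s -> (i < n)%N.
  by move=> si; rewrite /n (big_rem _ si) leq_max leqnn.
exists n, (\col_i if (i : nat) \in s then proj i d : R else 0).
rewrite mxE [RHS](eq_bigr (fun i : 'I_n => if (i : nat) \in s then
  inj i (proj i d) else 0)); last first.
  by move=> i _; rewrite !mxE; case: ifP => _; rewrite ?ractr0 // injE.
rewrite -big_mkcond /= -(big_mkord (fun i => i \in s) (fun i => inj i (proj i d))).
rewrite -[RHS]big_filter; apply: perm_big; apply: uniq_perm => //.
  by rewrite filter_uniq // iota_uniq.
move=> i; rewrite mem_filter mem_index_iota /=; case si: (i \in s) => //=.
by rewrite (sn _ si).

Qed.

Lemma free_hom_ext (L : rmodType R) (h h' : {linear D -> L}) :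
  (forall i, h (inj i (1 : R)) = h' (inj i (1 : R))) -> h =1 h'.
Proof.
move=> hh' d; have [n [r ->]] := free_decomp d.
have E (g : {linear D -> L}) : g (rmulmx (row_e n) r 0 0) =
    rmulmx (map_mx g (row_e n)) r 0 0 by rewrite -map_rmulmx [RHS]mxE.
rewrite !E; congr (rmulmx _ r 0 0).
by apply/rowP => i; rewrite !mxE hh'.
Qed.

Lemma free_enum : countable [set: R] ->
  exists s : nat -> D, forall d, exists n, s n = d.
Proof.
move=> /(countable_enum (0 : R))[a aP].
pose f (t : seq nat) := rmulmx (row_e (size t)) (\col_i a (nth 0%N t i)) 0 0.
exists (fun n => if unpickle n is Some t then f t else 0) => d.
have [n [r ->]] := free_decomp d; have /choice[b bP] := fun i => aP (r i 0).
exists (pickle [seq b i | i <- enum 'I_n]); rewrite pickleK /f.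
rewrite !mxE size_map size_enum_ord; apply: eq_bigr => i _.
rewrite !mxE (nth_map i) ?size_enum_ord // nth_ord_enum.
by rewrite bP.
Qed.

(** One step of the chain. If v r = 0, the images x of the first n basis elements satisfy x = y A
    with A r = 0; u rewrites these basis elements through A in terms of new ones lying over y, which
    kills r. *)
Lemma kill_relation (C : rmodType R) (v : {linear D -> C}) (r : D) : eqflat C ->
  exists (u : {linear D -> D}) (v' : {linear D -> C}),
    (forall x, v' (u x) = v x) /\ (v r = 0 -> u r = 0).
Proof.
move=> fC; case: (pselect (v r = 0)) => [vr|nvr]; last first.
  by exists idfun, v; split.
have [n [rr rE]] := free_decomp r.
have xr : rmulmx (map_mx v (row_e n)) rr = 0.
  by apply/rowP => i; rewrite ord1 -map_rmulmx mxE -rE vr mxE.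
have [m [y [A [xE Ar]]]] := fC _ _ _ xr.
(* The new elements take the first m places: u sends e_i to the i-th entry of e A for i < n and to
   e_(m+i) otherwise, and v' undoes the shift. *)
have [u uP] := free_lift_basis (fun i =>
  if insub i is Some i' then rmulmx (row_e m) A 0 (i' : 'I_n) else e (m + i)).
have [v' v'P] := free_lift_basis (fun j =>
  if insub j is Some j' then y 0 (j' : 'I_m) else v (e (j - m))).
have v'row : map_mx v' (row_e m) = y.
  by apply/rowP => j; rewrite !mxE v'P valK.
have urow : map_mx u (row_e n) = rmulmx (row_e m) A.
  by apply/rowP => i; rewrite !mxE uP valK mxE.
exists u, v'; split=> [x|_]; last first.
  transitivity (rmulmx (map_mx u (row_e n)) rr 0 0).
    by rewrite -map_rmulmx mxE rE.
  by rewrite urow rmulmxA Ar rmulmx0 mxE.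
rewrite -[LHS]/((v' \o u) x); apply: free_hom_ext x => i /=; rewrite uP.
case: insubP => [i' _ <-|].
  transitivity (map_mx v' (rmulmx (row_e m) A) 0 i'); first by rewrite [RHS]mxE.
  by rewrite map_rmulmx v'row -xE !mxE.
rewrite -leqNgt => ni; rewrite v'P insubF ?addKn //.
by rewrite ltnNge leq_addr.
Qed.

(** Every pair (m, x) comes up at a stage k >= m, where the image of x in the k-th copy is killed if
    it is zero in C. *)
Lemma flat_direct_limit (C : rmodType R) (c : nat -> C) :
  countable [set: R] -> eqflat C -> (forall x, exists n, c n = x) ->
  exists (u : nat -> {linear D -> D}) (v : nat -> {linear D -> C}),
    is_direct_limit (F := fun=> D) u v.
Proof.
move=> /free_enum[s /pair_enum[dec decP]] fC cP.
have [v0 v0P] := free_lift_basis c.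
pose ku v r := sval (cid (kill_relation v r fC)).
pose kv v r := sval (cid (svalP (cid (kill_relation v r fC)))).
have kP v r : (forall x, kv v r (ku v r x) = v x) /\ (v r = 0 -> ku v r r = 0).
  exact: svalP (cid (svalP (cid (kill_relation v r fC)))).
(* The second component of the state transports elements of the m-th copy of D
   to the current one. *)
pose step k (st : {linear D -> C} * (nat -> D -> D)) :=
  let r := st.2 (dec k).1 (dec k).2 in
  (kv st.1 r, fun m => if (m <= k)%N then ku st.1 r \o st.2 m else id).
pose st := fix st k := if k is k'.+1 then step k' (st k') else (v0, fun=> id).
pose v k := (st k).1; pose tr k := (st k).2.
pose u k := ku (v k) (tr k (dec k).1 (dec k).2).
have vu k x : v k.+1 (u k x) = v k x.
  exact: (kP (v k) (tr k (dec k).1 (dec k).2)).1.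
have trS k m : (m <= k)%N -> tr k.+1 m = u k \o tr k m.
  by rewrite /tr /= => ->.
have trr k : tr k k = id by case: k => //= k; rewrite /tr /= ltnn.
have trw (X : rmodType R) (w : nat -> {linear D -> X}) m k x :
    (forall n y, w n.+1 (u n y) = w n y) -> (m <= k)%N -> w k (tr k m x) = w m x.
  move=> wu; elim: k => [|k IH]; first by rewrite leqn0 => /eqP ->; rewrite trr.
  rewrite leq_eqVlt => /predU1P[->|mk]; first by rewrite trr.
  by rewrite trS //= wu IH.
exists u, v; apply: is_direct_limit_surj => // [y|m x vx X w wu].
  by have [n <-] := cP y; exists (inj n (1 : R)); apply: v0P.
have [k [mk dk]] := decP m x.
rewrite -(trw X w m k.+1 x wu) ?(leqW mk) // trS //= /u dk.
by rewrite (kP _ _).2 ?linear0 // trw.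
Qed.

End CountableFree.

(** * Projectivity of countable flat Mittag-Leffler modules *)

Section CountableMittagLeffler.
Variables (R : pzRingType) (L : rmodType R) (c : nat -> L).
Hypothesis cP : forall l, exists k, c k = l.
Hypothesis LML : flat_ML L.

Let stable n (x : 'rV[L]_n) m (U : 'M[R]_(m, n)) :=
  forall m' (y' : 'rV[L]_m') (A' : 'M[R]_(m', n)), x = rmulmx y' A' ->
    exists B, U = B *m A'.

Let stable_chain : exists (n : nat -> nat) (x : forall k, 'rV[L]_(n k))
    (U : forall k, 'M[R]_(n k.+1, n k)),
  [/\ forall k, x k = rmulmx (x k.+1) (U k), forall k, stable (x k) (U k)
    & forall l, exists k i, x k 0 i = l].
Proof.
pose St := {n : nat & 'rV[L]_n}.
have next k (st : St) : exists st' : St, exists U : 'M[R]_(projT1 st', projT1 st),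
    [/\ projT2 st = rmulmx (projT2 st') U, stable (projT2 st) U
      & exists i, projT2 st' 0 i = c k].
  case: st => n x; have [m [y [A [xE Ast]]]] := flat_ML_stable x LML.
  (* Appending c_k against a zero block of U preserves both x = x' U and stability, and makes the
     tuples exhaust L. *)
  exists (existT _ (m + 1)%N (row_mx y (const_mx (c k)))), (col_mx A 0) => /=.
  split; first by rewrite rmulmx_block rmulmx0 addr0.
    move=> m' y' A' /Ast[B ->]; exists (col_mx B 0).
    by rewrite mul_col_mx mul0mx.
  by exists (rshift m ord0); rewrite row_mxEr mxE.
pose st := fix st k : St :=
  if k is k'.+1 then sval (cid (next k' (st k')))
  else existT (fun m => 'rV[L]_m) 0%N (const_mx 0).
pose U k : 'M[R]_(projT1 (st k.+1), projT1 (st k)) :=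
  sval (cid (svalP (cid (next k (st k))))).
have UP k := svalP (cid (svalP (cid (next k (st k))))).
exists (fun k => projT1 (st k)), (fun k => projT2 (st k)), U.
split=> [k|k|l]; first by have [] := UP k.
  by have [] := UP k.
by have [k <-] := cP l; have [_ _ [i iP]] := UP k; exists k.+1, i.
Qed.

(** Lifts s_k of the x_(k+1) are chosen so that the t_k = s_k U_k lift the x_k coherently; the lift
    of f then sends x_k r to t_k r. *)
Lemma countable_flat_ML_projective : projective L.
Proof.
move=> A B p f sp; have [n [x [U [xU Ust xsurj]]]] := stable_chain.
pose lifts k (s : 'rV[A]_(n k.+1)) := map_mx p s = map_mx f (x k.+1).
have lift0 m (z : 'rV[L]_m) : exists s, map_mx p s = map_mx f z.
  have /choice[s sP] := fun i => sp (f (z 0 i)).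
  by exists (\row_i s i); apply/rowP => i; rewrite !mxE.
have next k (s : {s | lifts k s}) : exists s' : {s' | lifts k.+1 s'},
    rmulmx (rmulmx (sval s') (U k.+1)) (U k) = rmulmx (sval s) (U k).
  case: s => s ps /=; have [w pw] := lift0 _ (x k.+2).
  (* Stability against x_k = x_(k+2) (U_(k+1) U_k) gives C. The arbitrary lift w is corrected by (s
     - w U_(k+1)) C, which p kills and which changes w U_(k+1) U_k into s U_k. *)
  have [|C UE] := Ust k _ (x k.+2) (U k.+1 *m U k).
    by rewrite -rmulmxA -!xU.
  have ps' : lifts k.+1 (w + rmulmx (s - rmulmx w (U k.+1)) C).
    rewrite /lifts raddfD /= map_rmulmx raddfB /= map_rmulmx ps pw -map_rmulmx.
    by rewrite -xU subrr rmul0mx addr0.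
  exists (exist _ _ ps') => /=; rewrite rmulmxA [LHS]rmulmxDl rmulmxA -UE.
  by rewrite rmulmxBl rmulmxA addrC subrK.
have [s0 ps0] := lift0 _ (x 1%N).
pose s := fix s k : {s | lifts k s} :=
  match k return {s | lifts k s} with
  | 0 => exist _ s0 ps0 | k'.+1 => sval (cid (next k' (s k'))) end.
pose t k := rmulmx (sval (s k)) (U k).
have tU k : rmulmx (t k.+1) (U k) = t k := svalP (cid (next k (s k))).
have pt k : map_mx p (t k) = map_mx f (x k).
  by rewrite map_rmulmx (svalP (s k)) -map_rmulmx -xU.
pose G l a := exists k (r : 'cV_(n k)),
  l = rmulmx (x k) r 0 0 /\ a = rmulmx (t k) r 0 0.
have later k k' (r : 'cV_(n k)) : (k <= k')%N -> exists r' : 'cV_(n k'),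
    rmulmx (x k') r' = rmulmx (x k) r /\ rmulmx (t k') r' = rmulmx (t k) r.
  elim: k' => [|k' IH]; first by rewrite leqn0 => /eqP k0; subst k; exists r.
  rewrite leq_eqVlt => /predU1P[e|/IH[r' [xr tr]]]; first by subst k; exists r.
  by exists (U k' *m r'); rewrite -!rmulmxA -xU tU.
have [||a|h hP] := @lin_of_rel _ L A G.
- move=> l; have [k [i <-]] := xsurj l; exists (t k 0 i), k, (delta_mx i 0).
  have E (V : rmodType R) (z : 'rV[V]_(n k)) : rmulmx z (delta_mx i 0) 0 0 = z 0 i.
    rewrite mxE (bigD1 i) //= mxE !eqxx ract1 big1 ?addr0 // => j ji.
    by rewrite mxE (negPf ji) ractr0.
  by rewrite !E.
- move=> a _ _ _ _ [k [r [-> ->]]] [k' [r' [-> ->]]].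
  have [r1 [<- <-]] := later _ _ r (leq_maxl k k').
  have [r2 [<- <-]] := later _ _ r' (leq_maxr k k').
  exists (maxn k k'), (\col_i (r1 i 0 * (a : R)) + r2).
  have E (V : rmodType R) m (z : 'rV[V]_m) (q q' : 'cV[R]_m) :
      a *: rmulmx z q 0 0 + rmulmx z q' 0 0 =
      rmulmx z (\col_i (q i 0 * (a : R)) + q') 0 0.
    rewrite !mxE scaler_sumr -big_split; apply: eq_bigr => i _.
    by rewrite !mxE ractDr -ractA.
  by rewrite -!E.
(* If x_k r = 0, then x_k = y A' with A' r = 0; stability gives U_k = C A', so t_k r = t_(k+1) U_k r
   = 0. *)
- move=> [k [r [e ->]]].
  have xr : rmulmx (x k) r = 0 by apply/rowP => i; rewrite ord1 -e mxE.
  have [m [y [A' [xE Ar]]]] := flat_eqflat LML.1 xr.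
  have [C UE] := Ust k _ _ _ xE.
  by rewrite -tU UE rmulmxA -mulmxA Ar mulmx0 rmulmx0 mxE.
exists h => l; have [k [r [-> ->]]] := (hP l (h l)).2 erefl.
have E (V W : rmodType R) (g : {linear V -> W}) (z : 'rV[V]_(n k)) :
    g (rmulmx z r 0 0) = rmulmx (map_mx g z) r 0 0 by rewrite -map_rmulmx [RHS]mxE.
by rewrite !E pt.
Qed.

End CountableMittagLeffler.

(** * Filtrations of flat modules over countable rings *)

(** A countable Skolem hull: each stage lists the previous one together with all entries of
    operations applied to lists from it. *)
Lemma countable_closure (V : Type) (x0 : V) (op : nat -> seq V -> seq V) :
  exists e : nat -> V, (exists j, e j = x0) /\
    forall k s i, exists j, e j = nth x0 (op k [seq e j | j <- s]) i.
Proof.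
pose task : Type := (nat + (nat * seq nat * nat))%type.
pose run (l : nat -> V) (o : option task) :=
  match o with
  | Some (inl t) => l t
  | Some (inr (k, s, i)) => nth x0 (op k [seq l j | j <- s]) i
  | None => x0
  end.
pose lv := fix lv n t : V := if n is n'.+1 then run (lv n') (unpickle t) else x0.
have lvE n (t : task) : lv n.+1 (pickle t) = run (lv n) (Some t).
  by rewrite -[LHS]/(run (lv n) (unpickle (pickle t))) pickleK.
have lv_mono n m t : (n <= m)%N -> exists t', lv m t' = lv n t.
  elim: m t => [|m IH] t; first by rewrite leqn0 => /eqP ->; exists t.
  rewrite leq_eqVlt => /predU1P[->|/(IH t)[t' <-]]; first by exists t.
  by exists (pickle (inl t' : task)); rewrite lvE.
pose e j := if unpickle j is Some (n, t) then lv n t else x0.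
have eE n t : e (pickle (n, t)) = lv n t by rewrite /e pickleK.
have e_lv j : exists n t, e j = lv n t.
  by rewrite /e; case: unpickle => [[n t]|]; [exists n, t | exists 0%N, 0%N].
exists e; split=> [|k s i]; first by exists (pickle (0%N, 0%N)); apply: eE.
have [n [s' ->]] : exists n s', [seq e j | j <- s] = [seq lv n t | t <- s'].
  elim: s => [|j s [n [s' /= ->]]]; first by exists 0%N, [::].
  have [m [t ->]] := e_lv j; exists (maxn m n).
  have [t0 <-] := lv_mono _ _ t (leq_maxl m n).
  have /choice[g gP] : forall t', exists t1, lv (maxn m n) t1 = lv n t'.
    by move=> t'; apply/lv_mono/leq_maxr.
  exists (t0 :: map g s'); rewrite /= -map_comp; congr cons.
  by apply: eq_map => t' /=; rewrite gP.
exists (pickle (n.+1, pickle (inr (k, s', i) : task))).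
by rewrite eE lvE.
Qed.

Section PureSubmodules.
Variable R : pzRingType.
Implicit Types (F L : rmodType R).

Definition row_in L (C : L -> Prop) n (x : 'rV[L]_n) : Prop := forall i, C (x 0 i).

(* The equational criterion for F/N, expressed in F. *)
Definition eqflat_quotient F (N : F -> Prop) : Prop :=
  forall n (x : 'rV[F]_n) (r : 'cV[R]_n), row_in N (rmulmx x r) ->
    exists m (y : 'rV[F]_m) (A : 'M[R]_(m, n)),
      row_in N (x - rmulmx y A) /\ A *m r = 0.

(** Purity of C in F. Writing the constants as c B builds in closure under linear combinations, by
    taking A to be the identity. *)
Definition systems_closed F (C : F -> Prop) : Prop :=
  forall m n p (A : 'M[R]_(m, n)) (B : 'M[R]_(p, n)) (c : 'rV[F]_p) y,
    row_in C c -> rmulmx y A = rmulmx c B ->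
    exists2 y', row_in C y' & rmulmx y' A = rmulmx c B.

Lemma systems_closed_submodule F (C : F -> Prop) :
  systems_closed C -> submodule (S := R^c) C.
Proof.
move=> CP; have Cmul p (c : 'rV[F]_p) (B : 'M[R]_(p, 1)) :
    row_in C c -> C (rmulmx c B 0 0).
  move=> Cc; have [y Cy] := CP _ _ _ 1%:M B c (rmulmx c B) Cc (rmulmx1 _).
  by rewrite rmulmx1 => <-.
split; first by have := Cmul 0%N 0 0; rewrite rmulmx0 mxE; apply=> -[].
move=> a x y Cx Cy.
have := Cmul (1 + 1)%N (row_mx (const_mx x) (const_mx y))
  (col_mx (const_mx (a : R)) (const_mx 1)).
rewrite rmulmx_block !mxE !big_ord1 !mxE ract1; apply=> i.
by case: (split_ordP i) => j ->; rewrite ?row_mxEl ?row_mxEr mxE.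
Qed.

Lemma systems_closed_eqflat F (C : F -> Prop) : systems_closed C -> eqflat F ->
  forall n (x : 'rV[F]_n) (r : 'cV[R]_n), row_in C x -> rmulmx x r = 0 ->
    exists m (y : 'rV[F]_m) (A : 'M[R]_(m, n)),
      [/\ row_in C y, x = rmulmx y A & A *m r = 0].
Proof.
move=> CP fF n x r Cx /fF[m [y [A [xE Ar]]]].
have [|y' Cy' y'A] := CP _ _ _ A 1%:M x y Cx; first by rewrite rmulmx1.
by exists m, y', A; split=> //; rewrite y'A rmulmx1.
Qed.

(** If x r lies in C, then x r = x' r for some x' in C, and the criterion in F applies to x - x'. *)
Lemma systems_closed_quotient F (C : F -> Prop) :
  systems_closed C -> eqflat F -> eqflat_quotient C.
Proof.
move=> CP fF n x r Cxr.
have [|x' Cx' x'r] := CP _ _ _ r 1%:M (rmulmx x r) x Cxr; first by rewrite rmulmx1.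
have [|m [y [A [xE Ar]]]] := fF _ (x - x') r.
  by rewrite rmulmxBl x'r rmulmx1 subrr.
by exists m, y, A; split=> // i; rewrite -xE opprB addrC subrK; apply: Cx'.
Qed.

(** Over a countable ring there are countably many pairs (A, B); each gives an operation returning a
    chosen solution for the constants in a list. *)
Lemma systems_closure F (x0 : F) : countable [set: R] ->
  exists e : nat -> F,
    (exists j, e j = x0) /\ systems_closed (fun x => exists j, e j = x).
Proof.
move=> /(countable_enum (0 : R))[a aP].
pose mx m n (t : seq (seq nat)) : 'M[R]_(m, n) :=
  \matrix_(i, j) a (nth 0%N (nth [::] t i) j).
have mxP m n (A : 'M[R]_(m, n)) : exists t, A = mx m n t.
  have /choice[b bP] := fun ij : 'I_m * 'I_n => aP (A ij.1 ij.2).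
  exists [seq [seq b (i, j) | j <- enum 'I_n] | i <- enum 'I_m].
  apply/matrixP => i j; rewrite mxE (nth_map i) ?size_enum_ord //.
  by rewrite nth_ord_enum (nth_map j) ?size_enum_ord // nth_ord_enum bP.
pose K : Type := (nat * nat * nat * seq (seq nat) * seq (seq nat))%type.
pose sol m n p (ta tb : seq (seq nat)) (s : seq F) (y : 'rV[F]_m) :=
  rmulmx y (mx m n ta) = rmulmx (\row_(i < p) nth 0 s i) (mx p n tb).
pose op k (s : seq F) : seq F :=
  if unpickle k is Some (m, n, p, ta, tb) then
    if pselect (exists y, sol m n p ta tb s y) is left h
    then [seq sval (cid h) 0 i | i <- enum 'I_m] else [::]
  else [::].
have [e [e0 eop]] := countable_closure x0 op.
exists e; split=> // m n p A B c y Cc yA.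
have [ta AE] := mxP _ _ A; have [tb BE] := mxP _ _ B.
have /choice[g gP] := Cc.
pose s := [seq g i | i <- enum 'I_p].
have sE : \row_(i < p) nth 0 [seq e j | j <- s] i = c.
  apply/rowP => i; rewrite mxE -map_comp (nth_map i) ?size_enum_ord //=.
  by rewrite nth_ord_enum gP.
have h : exists y, sol m n p ta tb [seq e j | j <- s] y.
  by exists y; rewrite /sol sE -AE -BE.
exists (sval (cid h)); last first.
  by move: (sval _) (svalP (cid h)) => z; rewrite /sol sE -AE -BE.
move=> i; have [j jE] := eop (pickle ((m, n, p, ta, tb) : K)) s i.
exists j; rewrite jE /op pickleK; case: pselect => // h'.
by rewrite (Prop_irrelevance h' h) (nth_map i) ?size_enum_ord // nth_ord_enum.
Qed.

End PureSubmodules.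

Section Deconstruction.
Variables (R : pzRingType) (F M : rmodType R).
Hypothesis countableR : countable [set: R].
Hypothesis fF : eqflat F.
Hypothesis ExtM : forall (C : rmodType R) (c : nat -> C),
  (forall x, exists n, c n = x) -> eqflat C -> Ext1_eq0 C M.

(* The successor step of the filtration: X' is the preimage in X of a submodule
   of F containing that of Q, with countable flat quotient. *)
Lemma eqflat_countable_extension (X Q : rmodType R) (p : {linear X -> F})
    (q : {linear Q -> X}) (f : {linear Q -> M}) :
  (forall y, exists x, p x = y) -> injective q ->
  eqflat_quotient (fun y => exists z, p (q z) = y) ->
  (forall x, p x = 0 -> exists z, q z = x) ->
  forall x0, exists (X' : rmodType R) (j : {linear X' -> X})
      (g : {linear X' -> M}),
    [/\ injective j, forall z, exists x', j x' = q z /\ g x' = f z,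
      eqflat_quotient (fun y => exists x', p (j x') = y),
      forall x, p x = 0 -> exists x', j x' = x
    & exists x', j x' = x0].
Proof.
move=> sp qinj Nflat kerp x0.
have [|F' [pi [spi piP]]] := @quotient_exists _ F (fun y => exists z, p (q z) = y).
  split; first by exists 0; rewrite !linear0.
  by move=> a _ _ [z <-] [z' <-]; exists (a *: z + z'); rewrite !linearP.
have lift n (x : 'rV[F']_n) : exists x', x = map_mx pi x'.
  have /choice[x' xE] := fun i => spi (x 0 i).
  by exists (\row_i x' i); apply/rowP => i; rewrite !mxE.
have fF' : eqflat F'.
  move=> n x r; have [{}x ->] := lift _ x => xr.
  have [|m [y [A [xE Ar]]]] := Nflat n x r.
    by move=> i; apply/piP; rewrite ord1; have := congr1 (fun z : 'rV_1 => z 0 0) xr;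
       rewrite -map_rmulmx !mxE.
  exists m, (map_mx pi y), A; split=> //; rewrite -map_rmulmx; apply/rowP => i.
  have /piP/eqP := xE i; rewrite 2!mxE linearB subr_eq0 => /eqP.
  by rewrite !mxE.
(* A countable pure submodule C of the flat module F' through the class of x0; both C and F'/C are
   then flat. *)
have [e [[j0 ej0] eC]] := systems_closure (pi (p x0)) countableR.
pose C (y : F') := exists j, e j = y; rewrite -/C in eC.
have CP := systems_closed_submodule eC.
have [C' [iota [iinj iP]]] := submodule_exists CP.
have fC' : eqflat C'.
  move=> n x r xr; have [||m [y [A [Cy yA Ar]]]] :=
    systems_closed_eqflat eC fF' (x := map_mx iota x) (r := r).
  - by move=> i; rewrite mxE; apply/iP; exists (x 0 i).
  - by rewrite -map_rmulmx xr map_mx0.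
  have /choice[y' yE] := fun i => (iP _).1 (Cy i).
  exists m, (\row_i y' i), A; split=> //; apply/rowP => i; apply: iinj.
  have := congr1 (fun z : 'rV_n => z 0 i) yA; rewrite mxE => ->.
  have -> : y = map_mx iota (\row_i y' i) by apply/rowP => l; rewrite !mxE yE.
  by rewrite -map_rmulmx [LHS]mxE.
have /choice[c' cE] : forall j, exists z, iota z = e j.
  by move=> j; apply/iP; exists j.
have cC' : forall x, exists n, c' n = x.
  move=> x; have /iP[j ej] : exists k, iota k = iota x by exists x.
  by exists j; apply: iinj; rewrite cE.
have [|X' [j [jinj jP]]] := @submodule_exists _ X (fun x => C (pi (p x))).
  by split=> [|a x y Cx Cy]; rewrite ?linear0 ?(linearP p) ?(linearP pi);
     [apply: CP.1 | apply: CP.2].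
have piq z : pi (p (q z)) = 0 by apply/piP; exists z.
have Cj x' : C (pi (p (j x'))) by apply/jP; exists x'.
have [|p' p'P] := corestrict (h := pi \o (p \o j)) iinj.
  by move=> x' /=; apply/iP/Cj.
have [|q' q'P] := corestrict (h := q) jinj.
  by move=> z; apply/jP; rewrite piq; apply: CP.1.
(* X' maps onto C' with kernel the image of q, so f extends to X' by the vanishing of Ext^1(C',
   M). *)
have [|||g gP] := (Ext1_eq0P C' M).1 (ExtM cC' fC') X' Q p' q' f.
- move=> z; have Cz : C (iota z) by apply/iP; exists z.
  have [y yE] := spi (iota z); have [x xE] := sp y.
  have /jP[x' x'E] : C (pi (p x)) by rewrite xE yE.
  by exists x'; apply: iinj; rewrite p'P /= x'E xE.
- move=> x'; split=> [px'|[z <-]].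
    have /piP[z qz] : pi (p (j x')) = 0 by rewrite -[LHS]p'P px' linear0.
    have [z' qz'] : exists z', q z' = j x' - q z.
      by apply: kerp; rewrite linearB qz subrr.
    by exists (z' + z); apply: jinj; rewrite q'P linearD qz' subrK.
  by apply: iinj; rewrite p'P /= q'P piq linear0.
- by move=> z qz; rewrite (qinj z 0) ?linear0 // -q'P qz linear0.
exists X', j, g; split=> //.
- by move=> z; exists (q' z); rewrite q'P gP.
- move=> n x r Nxr; have [|m [y [A [xE Ar]]]] :=
    systems_closed_quotient eC fF' (x := map_mx pi x) (r := r).
    move=> i; rewrite -map_rmulmx mxE; have [x' <-] := Nxr i; exact: Cj.
  have [y' yE] := lift _ y; exists m, y', A; split=> // i.
  have [z pz] := sp ((x - rmulmx y' A) 0 i).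
  have /jP[x' jx'] : C (pi (p z)).
    by rewrite pz; have := xE i; rewrite yE -map_rmulmx -raddfB mxE.
  by exists x'; rewrite jx'.
- by move=> x px; apply/jP; rewrite px linear0; apply: CP.1.
- by apply/jP; exists j0.
Qed.
(** Zorn's lemma on graphs of partial extensions of f for which F modulo the image of the domain is
    flat; the successor step both requires and preserves this condition. *)
Lemma flat_Ext1_eq0 : Ext1_eq0 F M.
Proof.
apply/Ext1_eq0P => X Q p q f sp kp kq.
have pq z : p (q z) = 0 by apply/kp; exists z.
pose dom (G : set (X * M)) y := exists g, G g /\ p g.1 = y.
pose ok (G : set (X * M)) :=
  [/\ forall a g h, G g -> G h -> G (a *: g + h), forall m, G (0, m) -> m = 0,
      forall z, G (q z, f z) & eqflat_quotient (dom G)].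
have ok0 : ok (fun g => exists z, g = (q z, f z)).
  split=> [a _ _ [z ->] [z' ->]|m [z [/esym/kq fz ->]]//|z|n x r Nxr].
  - exists (a *: z + z'); rewrite !linearP.
    exact: injective_projections.
  - by exists z.
  - have xr : rmulmx x r = 0.
      apply/rowP => i; have [_ [[z ->] /= <-]] := Nxr i; by rewrite pq mxE.
    have [m [y [A [-> Ar]]]] := fF xr; exists m, y, A; split=> // i.
    exists (q 0, f 0); split; first by exists 0.
    by rewrite subrr mxE pq.
(* The empty graph is admitted so that P is closed under unions of all chains,
   the empty one included. *)
pose P (G : set (X * M)) := (exists g, G g) -> ok G.
have [Fam FamP Ftot [g1 [G0 FG0 G0g1]]|G [PG Gmax]] := @Zorn_bigcup _ P.
  have okF G g : Fam G -> G g -> ok G by move=> FG Gg; apply: (FamP G FG); exists g.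
  have okG0 := okF _ _ FG0 G0g1.
  split.
  - move=> a g h [G1 FG1 G1g] [G2 FG2 G2h].
    have [G3 [FG3 G3g G3h]] : exists G3, [/\ Fam G3, G3 g & G3 h].
      by case: (Ftot _ _ FG1 FG2) => [/(_ _ G1g)|/(_ _ G2h)] ?;
        [exists G2 | exists G1].
    by exists G3 => //; have [lin _ _ _] := okF _ _ FG3 G3g; apply: lin.
  - by move=> m [G1 FG1 G1m]; have [_ fn _ _] := okF _ _ FG1 G1m; apply: fn.
  - by move=> z; exists G0 => //; case: okG0.
  (* The row x r has a single entry, so one member of the chain already witnesses the hypothesis. *)
  - move=> n x r Nxr; have [g [[G1 FG1 G1g] pg]] := Nxr 0.
    have [_ _ _ /(_ n x r)[|m [y [A [xE Ar]]]]] := okF _ _ FG1 G1g.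
      by move=> i; exists g; rewrite ord1.
    exists m, y, A; split=> // i; have [h [G1h ph]] := xE i.
    by exists h; split=> //; exists G1.
have [g0 Gg0] : exists g, G g.
  apply: contrapT => G0; apply: (Gmax _ _ (fun _ => ok0)).
  split=> [g Gg|sub]; first by case: G0; exists g.
  by apply: G0; exists (q 0, f 0); apply: sub; exists 0.
have [Glin Gfun Gbase Ggood] := PG (ex_intro _ _ Gg0).
have G00 : G (0, 0) by have := Gbase 0; rewrite !linear0.
have Gker x : p x = 0 -> exists m, G (x, m).
  by move=> /kp[z <-]; exists (f z).
suff Gtot x : exists m, G (x, m).
  have [||m|h hP] := @lin_of_rel _ X M (fun x m => G (x, m)).
  - exact: Gtot.
  - by move=> a x m x' m'; apply: Glin.
  - exact: Gfun.
  by exists h => z; apply/esym/hP.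
have [|X1 [q1 [q1inj q1P]]] := @submodule_exists _ X (fun x => exists m, G (x, m)).
  split; first by exists 0.
  move=> a y y' [m Gm] [m' Gm']; exists (a *: m + m').
  exact: (Glin a _ _ Gm Gm').
have q1G z : exists m, G (q1 z, m) by apply/q1P; exists z.
have [||m|f1 f1P] := @lin_of_rel _ X1 M (fun z m => G (q1 z, m)).
- exact: q1G.
- by move=> a z m z' m'; rewrite linearP; apply: Glin.
- by rewrite linear0; apply: Gfun.
have [|y yp|X' [j [g [jinj jg jgood jker [x' jx']]]]] :=
  @eqflat_countable_extension X X1 p q1 f1 sp q1inj _ _ x.
- move=> n y r Nyr; have [|m [z [A [yE Ar]]]] := Ggood n y r.
    by move=> i; have [z <-] := Nyr i; have [m Gm] := q1G z; exists (q1 z, m).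
  exists m, z, A; split=> // i; have [[w m'] [Gw <-]] := yE i.
  by have /q1P[w' <-] : exists m, G (w, m) by [exists m']; exists w'.
- by apply/q1P/Gker.
pose G' (h : X * M) := exists w, h = (j w, g w).
have GG' h : G h -> G' h.
  case: h => w m Gw; have /q1P[w1 w1E] : exists m, G (w, m) by exists m.
  have [w' [jw' gw']] := jg w1; exists w'; rewrite jw' gw' w1E; congr pair.
  by apply/f1P; rewrite w1E.
apply: contrapT => Nx; apply: (Gmax G').
  split=> // sub; apply: Nx; exists (g x'); rewrite -jx'.
  by apply: sub; exists x'.
move=> _; split.
- by move=> a _ _ [w ->] [w' ->]; exists (a *: w + w'); rewrite !linearP.
- by move=> m [w [/esym jw ->]]; rewrite (jinj w 0) ?linear0.
- by move=> z; apply/GG'/Gbase.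
- move=> n y r Nyr; have [|m [z [A [yE Ar]]]] := jgood n y r.
    by move=> i; have [_ [[w ->] /= pw]] := Nyr i; exists w.
  exists m, z, A; split=> // i; have [w pw] := yE i.
  by exists (j w, g w); split=> //; exists w.
Qed.

End Deconstruction.

(** * Precovers, perfect rings and the conclusion *)

Lemma countable_eqflat_direct_limit (R : pzRingType) (C : rmodType R)
    (c : nat -> C) :
  countable [set: R] -> (forall x, exists n, c n = x) -> eqflat C ->
  exists (F : nat -> rmodType R) (u : forall n, {linear F n -> F n.+1})
    (v : forall n, {linear F n -> C}),
    (forall n, flat_ML (F n)) /\ is_direct_limit u v.
Proof.
move=> cR cP fC; have [D [inj [proj HD]]] := @dsum_exists _ nat (fun=> (R^c)^o).
have [u [v lim]] := flat_direct_limit HD cR fC cP.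
exists (fun=> D), u, v; split=> // _.
by apply: (flat_ML_dsum HD) => _; apply: flat_ML_regular.
Qed.

Lemma right_perfect_precovering (R : pzRingType) :
  right_perfect R -> precovering (@flat_ML R).
Proof.
move=> perfR M; have [D [inj [proj [p [HD sp]]]]] := free_cover M.
exists D, p; split; first by apply: (flat_ML_dsum HD) => _; apply: flat_ML_regular.
move=> B f [/perfR prB _]; have [g gP] := prB _ _ p f sp.
by exists g => x; rewrite gP.
Qed.

(** It suffices that countable flat modules C are projective. A precover of C splits because C is
    the limit of a chain in the class, so C is a countable flat Mittag-Leffler module. *)
Lemma precovering_right_perfect (R : pzRingType) : countable [set: R] ->
  precovering (@flat_ML R) -> right_perfect R.
Proof.
move=> cR preD F /flat_eqflat fF; apply: Ext1_projective => M.
apply: (flat_Ext1_eq0 cR fF) => C c cP fC; apply: projective_Ext1.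
have [G [u [v [GML lim]]]] := countable_eqflat_direct_limit cR cP fC.
have [A [f [AML fpre]]] := preD C.
have [E h EML|s sP] := direct_limit_split (f := f) GML lim.
  by have [g gP] := fpre E h EML; exists g.
exact: countable_flat_ML_projective cP (flat_ML_retract AML sP).
Qed.

Theorem theorem6 (R : pzRingType) :
  (forall (F : nat -> rmodType R) (u : forall n, {linear F n -> F n.+1})
          (L : rmodType R) (v : forall n, {linear F n -> L}),
      (forall n, flat_ML (F n)) -> is_direct_limit u v ->
      left_perp (right_perp (@flat_ML R)) L)
  /\
  (countable [set: R] ->
     (forall M : rmodType R, right_perp (@flat_ML R) M <-> cotorsion M)
     /\ (precovering (@flat_ML R) <-> right_perfect R)).
Proof.
split=> [F u L v|cR]; first exact: direct_limit_left_perp.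
split=> [M|]; last first.
  by split; [apply: precovering_right_perfect | apply: right_perfect_precovering].
split=> [MP F /flat_eqflat fF|cotM C [fC _]]; last exact: cotM.
apply: (flat_Ext1_eq0 cR fF) => C c cP fC.
have [G [u [v [GML lim]]]] := countable_eqflat_direct_limit cR cP fC.
exact: direct_limit_left_perp GML lim M MP.
Qed.
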